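(* Let $F=F(a_1,\dots,a_k)$ be a free group with free basis $A=\{a_1,\dots,a_k\}$, $k\ge 2$, and let $\mu_A$ be the uniform Borel probability measure on $\partial F$ corresponding to $A$. Let $\phi:F\to G$ be a homomorphism to a group $G$ endowed with a semi-norm, that is, a nonnegative function $|\cdot|_G$ on $G$ satisfying $|gh|_G\le |g|_G+|h|_G$ for all $g,h\in G$. Then: (1) There exists a real number $\lambda\ge 0$ such that $$\lim_{n\to\infty}\frac{|\phi(\omega_n)|_G}{n}=\lambda$$ for $\mu_A$-a.e. $\omega\in\partial F$ and in $L^1(\partial F,\mu_A)$. (2) Suppose further that the group $\phi(F)$ is non-amenable, and that the sequence $b_n=\#\{g\in\phi(F): |g|_G\le n\}$ grows at most exponentially. Then $\lambda>0$.
   Context: The boundary $\partial F$ is the set of all semi-infinite freely reduced words over $A^{\pm1}$ (equivalently geodesic rays from $1$ in the Cayley graph of $F$ with respect to $A$), with its standard topology and Borel $\sigma$-algebra generated by the cylinder sets $Cyl_A(v)$, $v\in F$, where $Cyl_A(v)$ is the set of all $\omega\in\partial F$ that begin with the freely reduced word $v$. For $\omega\in\partial F$, $\omega_n\in F$ denotes the initial segment of $\omega$ of length $n$. The uniform measure $\mu_A$ is the Borel probability measure on $\partial F$ with $\mu_A(Cyl_A(v))=\frac{1}{2k(2k-1)^{|v|-1}}$ for all $v\in F\setminus\{1\}$, where $|v|$ is the freely reduced length. ''Grows at most exponentially'' means that the $b_n$ are finite and bounded by $Ce^{cn}$ for some constants $C,c>0$. *)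

(* Defs.v *)
From HB Require Import structures.
From mathcomp Require Import all_boot all_order all_algebra all_fingroup.
From mathcomp Require Import finmap.
From mathcomp Require Import all_classical all_reals all_analysis.

Set Implicit Arguments.
Unset Strict Implicit.
Unset Printing Implicit Defensive.

Import Order.TTheory GRing.Theory Num.Theory.
Import numFieldNormedType.Exports.

Local Open Scope classical_set_scope.
Local Open Scope ring_scope.

(* [(i, true)] stands for the basis element a_i, [(i, false)] for its inverse. *)
Notation letter k := ('I_k * bool)%type.

Definition linv k (x : letter k) : letter k := (x.1, ~~ x.2).

Lemma linvK k : involutive (@linv k).
Proof. by case=> i b; rewrite /linv /= negbK. Qed.

Definition reduced k (w : seq (letter k)) : bool :=
  sorted (fun x y => y != linv x) w.

(* F(a_1, ..., a_k) as the set of freely reduced words.  The product is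
   concatenation followed by free reduction: [push x v] is the freely reduced
   form of [x :: v] when [v] is freely reduced. *)
Record free_group (k : nat) : Type :=
  FreeGroup { word :> seq (letter k); _ : reduced word }.

HB.instance Definition _ k := [isSub for @word k].
HB.instance Definition _ k := [Choice of free_group k by <:].

Section FreeGroup.
Variable k : nat.
Implicit Types (x y : letter k) (s t w : seq (letter k)) (u v : free_group k).

Definition push x w :=
  if w is y :: w' then (if y == linv x then w' else x :: w) else [:: x].

Lemma word_reduced u : reduced u. Proof. exact: valP. Qed.

Lemma push_reduced x w : reduced w -> reduced (push x w).
Proof.
case: w => [//|y w] /= ryw; case: ifP => [_|nyx]; first exact: path_sorted ryw.
by rewrite /reduced /= nyx.
Qed.

Lemma pushK x w : reduced w -> push (linv x) (push x w) = w.
Proof.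
case: w => [|y w] rw /=; first by rewrite linvK eqxx.
case: eqP => [yE|_]; last by rewrite /= linvK eqxx.
case: w rw => [|z w] /=; first by rewrite yE.
by rewrite yE /reduced /= => /andP[/negbTE -> _].
Qed.

Lemma foldr_push_reduced s w : reduced w -> reduced (foldr push w s).
Proof. by move=> rw; elim: s => //= x s; exact: push_reduced. Qed.

Lemma foldr_push x s w : reduced w ->
  foldr push w (push x s) = push x (foldr push w s).
Proof.
move=> rw; case: s => //= y s; case: eqP => // ->.
by rewrite -{1}[x]linvK pushK// foldr_push_reduced.
Qed.

Lemma foldr_pushA s t w : reduced w ->
  foldr push w (foldr push t s) = foldr push (foldr push w t) s.
Proof. by move=> rw; elim: s => //= x s <-; rewrite foldr_push. Qed.

Lemma foldr_push_nil s : reduced s -> foldr push [::] s = s.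
Proof.
elim: s => //= x s IHs rxs; rewrite IHs; last exact: path_sorted rxs.
by case: s rxs {IHs} => //= y s /andP[/negbTE -> _].
Qed.

Definition winv w := rev (map (@linv k) w).

Lemma winv_reduced w : reduced w -> reduced (winv w).
Proof.
rewrite /reduced /winv rev_sorted sorted_map => rw.
apply: sub_sorted rw => x y /=; apply: contraNN => /eqP ->.
by rewrite linvK.
Qed.

Lemma winvK : involutive winv.
Proof. by move=> w; rewrite /winv map_rev revK (mapK (@linvK k)). Qed.

Lemma foldr_push_winv w : foldr push w (winv w) = [::].
Proof.
elim: w => //= x w IHw.
by rewrite /winv /= rev_cons foldr_rcons /= linvK eqxx.
Qed.

Definition fg_one : free_group k := @FreeGroup k [::] isT.
Definition fg_mul u v : free_group k :=
  FreeGroup (foldr_push_reduced u (word_reduced v)).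
Definition fg_inv u : free_group k := FreeGroup (winv_reduced (word_reduced u)).

Lemma fg_mulA : associative fg_mul.
Proof.
by move=> u v w; apply: val_inj; rewrite /= foldr_pushA// word_reduced.
Qed.
Lemma fg_mul1 : left_id fg_one fg_mul.
Proof. by move=> u; apply: val_inj. Qed.
Lemma fg_mulr1 : right_id fg_one fg_mul.
Proof. by move=> u; apply: val_inj; rewrite /= foldr_push_nil// word_reduced. Qed.
Lemma fg_mulV : left_inverse fg_one fg_inv fg_mul.
Proof. by move=> u; apply: val_inj; exact: foldr_push_winv. Qed.
Lemma fg_mulrV : right_inverse fg_one fg_inv fg_mul.
Proof.
move=> u; apply: val_inj => /=.
by rewrite -{2}[word u]winvK foldr_push_winv.
Qed.

HB.instance Definition _ := isGroup.Build (free_group k)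
  fg_mulA fg_mul1 fg_mulr1 fg_mulV fg_mulrV.

End FreeGroup.

(* The semi-infinite freely reduced words.  The proof [hk] only serves to make
   the type inhabited, as required by [measurableType]. *)
Record boundary (k : nat) (hk : (2 <= k)%N) : Type := Boundary {
  ray :> nat -> letter k;
  rayP : forall n, ray n.+1 != linv (ray n) }.

Section Boundary.
Variables (k : nat) (hk : (2 <= k)%N).
Implicit Types (w : boundary hk) (v : free_group k).

Lemma initial_reduced w n : reduced (mkseq w n).
Proof.
apply/(sortedP (w 0%N)) => i; rewrite size_mkseq => lin.
by rewrite !nth_mkseq ?(ltnW lin)// rayP.
Qed.

Definition initial w n : free_group k := FreeGroup (initial_reduced w n).

Definition cylinder v : set (boundary hk) := [set w | initial w (size v) = v].

Definition ray0 : boundary hk :=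
  @Boundary k hk (fun=> (Ordinal (ltnW hk), true)) (fun=> isT).

HB.instance Definition _ := gen_eqMixin (boundary hk).
HB.instance Definition _ := gen_choiceMixin (boundary hk).
HB.instance Definition _ := isPointed.Build (boundary hk) ray0.
HB.instance Definition _ := Measurable.copy (boundary hk)
  (g_sigma_algebraType (range cylinder)).

End Boundary.

Definition is_uniform_measure (R : realType) (k : nat) (hk : (2 <= k)%N)
    (mu : probability (boundary hk) R) : Prop :=
  forall v : free_group k, v <> 1%g ->
    mu (cylinder v) =
      ((2 * k%:R * (2 * k%:R - 1) ^+ (size v - 1)%N)^-1 : R)%:E.

(* No symmetry |g^-1| = |g| and no value at 1 are required. *)
Definition semi_norm (R : realType) (G : groupType) (N : G -> R) : Prop :=
  (forall g, 0 <= N g) /\ (forall g h, N (g * h)%g <= N g + N h).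

(* Amenability (in the sense of von Neumann) of a subgroup [H] of [G], as a
   discrete group: there is a finitely additive left-invariant probability
   measure defined on all subsets of [H].  The values of [m] at sets that are
   not contained in [H] are irrelevant. *)
Definition amenable (R : realType) (G : groupType) (H : set G) : Prop :=
  exists m : set G -> R,
    [/\ forall B, B `<=` H -> 0 <= m B,
        m H = 1,
        forall B C, B `<=` H -> C `<=` H -> B `&` C = set0 ->
          m (B `|` C) = m B + m C
      & forall h B, H h -> B `<=` H -> m [set (h * g)%g | g in B] = m B].

Definition grows_at_most_exponentially (R : realType) (G : groupType)
    (N : G -> R) (H : set G) : Prop :=
  exists C c : R, [/\ 0 < C, 0 < c & forall n : nat,
    let ball := [set g | H g /\ N g <= n%:R] in
    finite_set ball /\ (#|` fset_set ball|)%:R <= C * expR (c * n%:R)].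

Definition cvg_L1 d (T : measurableType d) (R : realType)
    (mu : {measure set T -> \bar R}) (f : nat -> T -> R) (g : T -> R) : Prop :=
  [/\ forall n, mu.-integrable setT (EFin \o f n),
      mu.-integrable setT (EFin \o g)
    & (\int[mu]_x (`|f n x - g x|)%:E)%E @[n --> \oo] --> 0%E].

(* Main.v *)
(* The shift of the boundary preserves the uniform measure and is ergodic: for an
   invariant set [A], the masses [mu (A /\ {w_0 = x})] solve a linear system whose
   only solution is constant in [x], so [A] is independent of every cylinder and
   hence of itself.

   (1) [X_n = |phi(w_n)|] is subadditive along the shift.  The lower bound on
   [X_n / n] is the covering argument of Katznelson and Weiss.  The same argument,
   applied to [- sum_(i < n) X_m o S^i], gives the pointwise ergodic theorem for
   [X_m], and thereby the upper bound.

   (2) The distributions [p_n] of [phi(w_n)], split according to the first letter,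
   are driven by an averaging operator that contracts [l^2].  If [l^2]-mass is
   almost preserved during two consecutive steps, then by the parallelogram
   identity [v + z v] is almost invariant, where [v] is the component of [p_n] at a
   letter [z], and Reiter's condition yields an invariant mean.  In the non-amenable case
   [||p_n||_2] therefore decays exponentially, while [lambda = 0] would
   concentrate half of [p_n] on a ball of subexponential size. *)
From HB Require Import structures.
Require Import Defs.
From mathcomp Require Import all_boot all_order all_algebra all_fingroup.
From mathcomp Require Import finmap lra ring zify.
From mathcomp Require Import all_classical all_reals all_analysis.
From mathcomp Require Import measurable_realfun.

Set Implicit Arguments.
Unset Strict Implicit.
Unset Printing Implicit Defensive.

Import Order.TTheory GRing.Theory Num.Theory.
Import numFieldNormedType.Exports.
Local Open Scope classical_set_scope.
Local Open Scope ring_scope.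

Lemma nat_upper_bound (R : archiRealFieldType) (x : R) : exists n : nat, x <= n%:R.
Proof.
exists (Num.bound `|x|); apply: le_trans (ler_norm x) _.
by apply/ltW/archi_boundP.
Qed.

(** * The subadditive ergodic theorem *)

Section ErgodicTheorems.
Context d (T : measurableType d) (R : realType) (mu : probability T R).
Variable S : T -> T.
Implicit Types (Z : nat -> T -> R) (n m : nat) (w : T).

(* The orbit segment of [w] is cut greedily: at a good time jump ahead by a block
   along which [Z] grows at rate at most [a], at a bad time advance by one. *)
Lemma good_times_bound Z (M a : R) (L : nat) (Bad : set T) :
  0 <= M ->
  (forall n m w, (0 < n)%N -> (0 < m)%N ->
    Z (n + m)%N w <= Z n w + Z m (iter n S w)) ->
  (forall n w, (0 < n)%N -> Z n w <= M * n%:R) ->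
  (forall w, ~ Bad w ->
    exists l : nat, [/\ (0 < l)%N, (l <= L)%N & Z l w <= a * l%:R]) ->
  forall n w, (0 < n)%N -> Z n w <= a * n%:R +
    (M + `|a|) * (\sum_(0 <= i < n) \1_Bad (iter i S w) + L%:R).
Proof.
move=> M0 subZ ZM goodP n; have [p] := ubnP n.
have K0 : 0 <= M + `|a| by rewrite addr_ge0.
have aK : M <= a + (M + `|a|) by have := ler_norm (- a); rewrite normrN; lra.
have sum_ge0 q (v : T) : (0 : R) <= \sum_(0 <= i < q) \1_Bad (iter i S v).
  by rewrite sumr_ge0// => i _; rewrite indicE.
elim: p n => // p IHp n; rewrite ltnS => np w n0.
(* A segment no longer than [L] is absorbed by the error term [(M + |a|) * L]. *)
have [nL|Ln] := leqP n L.
  have nLR : n%:R <= L%:R :> R by rewrite ler_nat.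
  rewrite (le_trans (ZM n w n0))//.
  have -> : M * n%:R = (M - a) * n%:R + a * n%:R by ring.
  rewrite addrC lerD2l (@le_trans _ _ ((M + `|a|) * n%:R))//.
    by rewrite ler_wpM2r//; lra.
  by rewrite ler_wpM2l// (le_trans nLR)// lerDr.
(* Both kinds of move cut off a first block of length [l < n] and apply induction to the rest, which
   starts at [iter l S w]. *)
have jump l c : (0 < l)%N -> (l < n)%N -> Z l w <= c ->
    c <= a * l%:R + (M + `|a|) * \sum_(0 <= i < l) \1_Bad (iter i S w) ->
    Z n w <= a * n%:R +
      (M + `|a|) * (\sum_(0 <= i < n) \1_Bad (iter i S w) + L%:R).
  move=> l0 ln Zlc cl; have nE : n = (l + (n - l))%N by rewrite subnKC// ltnW.
  rewrite {1}nE (le_trans (subZ _ _ _ l0 _))// ?subn_gt0//.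
  have := IHp (n - l)%N _ (iter l S w) _.
  rewrite subn_gt0 ln (leq_trans _ np) ?ltn_subrL ?l0// => /(_ isT isT).
  rewrite [in X in _ -> X](big_cat_nat (n := l))//= ?(ltnW ln)//.
  have -> : \sum_(l <= i < n) \1_Bad (iter i S w) =
      \sum_(0 <= i < n - l) \1_Bad (iter i S (iter l S w)) :> R.
    rewrite -{1}[l]add0n big_addn; apply: eq_bigr => i _.
    by rewrite iterD.
  have -> : n%:R = l%:R + (n - l)%:R :> R by rewrite -natrD -nE.
  by move: Zlc cl; lra.
have [Bw|nBw] := pselect (Bad w); last first.
  have [l [l0 lL Zl]] := goodP _ nBw.
  apply: (jump l _ l0 (leq_ltn_trans lL Ln) Zl).
  by rewrite lerDl mulr_ge0.
have [n1|n1] := leqP n 1.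
  have {np jump Ln} -> : n = 1%N by lia.
  rewrite big_nat1/= indicE mem_set//= (le_trans (ZM _ _ _))//.
  have : 0 <= (M + `|a|) * L%:R by rewrite mulr_ge0.
  by move: aK; lra.
apply: (jump 1%N (M * 1)) => //; first exact: ZM.
by rewrite big_nat1/= indicE mem_set//=; move: aK; lra.
Qed.

Hypothesis mS : measurable_fun setT S.
Hypothesis muS : forall A, measurable A -> mu (S @^-1` A) = mu A.
Hypothesis ergS : forall A, measurable A -> S @^-1` A `<=` A ->
  mu A = 0%E \/ mu A = 1%E.

Lemma measurable_iter n : measurable_fun setT (iter n S).
Proof.
elim: n => [|n IHn]; first exact: measurable_id.
exact: (measurableT_comp mS IHn).
Qed.

Lemma measure_iter n A : measurable A -> mu (iter n S @^-1` A) = mu A.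
Proof.
elim: n A => // n IHn A mA.
rewrite -[RHS]muS// -[RHS]IHn//.
by rewrite -[X in measurable X]setTI; exact: mS.
Qed.

Lemma bounded_integrable (f : T -> R) : measurable_fun setT f ->
  (exists C : R, forall w, `|f w| <= C) -> mu.-integrable setT (EFin \o f).
Proof.
move=> mf [C fC]; apply: measurable_bounded_integrable => //.
  by rewrite [ltLHS]probability_setT ltry.
exists C; split; [exact: num_real|move=> x Cx w _].
exact: le_trans (fC w) (ltW Cx).
Qed.

Lemma integrable_sum_nat (f : nat -> T -> R) n :
  (forall i, mu.-integrable setT (EFin \o f i)) ->
  mu.-integrable setT (EFin \o (fun w => \sum_(0 <= i < n) f i w)).
Proof.
move=> fi; have -> : EFin \o (fun w => \sum_(0 <= i < n) f i w) =
    (fun w => (\sum_(0 <= i < n) (f i w)%:E)%E).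
  by apply/funext => w /=; rewrite sumEFin.
by apply: integrable_sum => // i _; exact: fi.
Qed.

Lemma Rintegral_sum_nat (f : nat -> T -> R) n :
  (forall i, mu.-integrable setT (EFin \o f i)) ->
  \int[mu]_w (\sum_(0 <= i < n) f i w) = \sum_(0 <= i < n) \int[mu]_w f i w.
Proof.
move=> fi; elim: n => [|n IHn].
  rewrite big_nil; under eq_Rintegral do rewrite big_nil.
  by rewrite Rintegral_cst// mul0r.
rewrite big_nat_recr//= -IHn -RintegralD//; last exact: integrable_sum_nat.
by apply: eq_Rintegral => w _; rewrite big_nat_recr.
Qed.

Lemma indic_iter_integrable A n : measurable A ->
  mu.-integrable setT (EFin \o (fun w => \1_A (iter n S w))).
Proof.
move=> mA; apply: bounded_integrable.
  apply: measurableT_comp; last exact: measurable_iter.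
  exact: measurable_indic.
by exists 1 => w; rewrite indicE ger0_norm// lern1 leq_b1.
Qed.

Lemma Rintegral_indic_iter A n : measurable A ->
  \int[mu]_w \1_A (iter n S w) = fine (mu A).
Proof.
move=> mA; rewrite /Rintegral -(measure_iter n mA).
have mn : measurable (iter n S @^-1` A).
  by rewrite -[X in measurable X]setTI; exact: measurable_iter.
by rewrite -[X in fine (mu X)]setIT -integral_indic.
Qed.

Lemma measurable_le_cst (f : T -> R) c : measurable_fun setT f ->
  measurable [set w | f w <= c].
Proof.
move=> mf; rewrite (_ : mkset _ = setT `&` f @^-1` `]-oo, c]); first exact: mf.
by apply/seteqP; split => w /=; rewrite in_itv/=; [|case].
Qed.

(** * Almost sure lower bound for subadditive sequences *)

Section LowerBound.
Variables (Z : nat -> T -> R) (M lam a : R).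
Hypothesis mZ : forall n, measurable_fun setT (Z n).
Hypothesis bZ : forall n, exists C : R, forall w, `|Z n w| <= C.
Hypothesis M0 : 0 <= M.
Hypothesis subZ : forall n m w, (0 < n)%N -> (0 < m)%N ->
  Z (n + m)%N w <= Z n w + Z m (iter n S w).
Hypothesis ZM : forall n w, (0 < n)%N -> Z n w <= M * n%:R.
Hypothesis lamZ : forall n, (0 < n)%N -> lam * n%:R <= \int[mu]_w Z n w.

(* [liminf Z_n / n <= c], up to a bounded error in [Z_n], which makes the set
   exactly (and not just almost) invariant *)
Let low (c : R) : set T := [set w | exists C : nat, forall m : nat, exists n : nat,
  (m <= n)%N /\ Z n w <= c * n%:R + C%:R].

Let measurable_low c : measurable (low c).
Proof.
have -> : low c = \bigcup_C \bigcap_m \bigcup_(n in [set n | (m <= n)%N])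
    [set w | Z n w <= c * n%:R + C%:R].
  apply/seteqP; split => w.
    by move=> [C wC]; exists C => // m _; have [n [mn Zn]] := wC m; exists n.
  by move=> [C _ wC]; exists C => m; have [n mn Zn] := wC m I; exists n.
apply: bigcupT_measurable => C; apply: bigcapT_measurable => m.
by apply: bigcup_measurable => n _; exact: measurable_le_cst.
Qed.

(** Prepending one step costs at most [M], and changing [c * n] to [c * (n + 1)] costs at most
    [|c|]; both go into the bounded error. *)
Let low_preimage c : S @^-1` low c `<=` low c.
Proof.
move=> w [C wC].
have [D MD] := nat_upper_bound (M + `|c| + C%:R).
exists D => m; have [n [mn Zn]] := wC m.+1.
exists n.+1; split; first exact: leqW (ltnW mn).
have n0 : (0 < n)%N by exact: leq_trans mn.
rewrite -addn1 addnC (le_trans (subZ _ _ _))//= natrD.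
have := ZM w (ltnSn 0); have := ler_norm (- c); rewrite normrN.
by move: MD Zn; lra.
Qed.

Let bad (c : R) (L : nat) : set T :=
  [set w | forall l : nat, (0 < l)%N -> (l <= L)%N -> c * l%:R < Z l w].

Let measurable_bad c L : measurable (bad c L).
Proof.
have -> : bad c L = \bigcap_(l in [set l | (0 < l)%N /\ (l <= L)%N])
    ~` [set w | Z l w <= c * l%:R].
  apply/seteqP; split => w wb l /=.
    by move=> [l0 lL]; apply/negP; rewrite -ltNge wb.
  by move=> l0 lL; rewrite ltNge; apply/negP; exact: wb.
apply: bigcap_measurableType => // l _.
by apply: measurableC; exact: measurable_le_cst.
Qed.

(** On [low a], arbitrarily large [n] satisfy [Z n w <= a * n + C], which is at most [c * n] once
    [n * (c - a) >= C]. So the decreasing sets [bad c L] have an intersection disjoint from [low a],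
    hence null, and continuity from above applies. *)
Let bad_small c : a < c -> mu (low a) = 1%E ->
  forall e : R, 0 < e -> exists2 L, (0 < L)%N & fine (mu (bad c L)) < e.
Proof.
move=> ac low1 e e0.
have cap0 : mu (\bigcap_L bad c L) = 0%E.
  apply: (@subset_measure0 _ _ _ _ _ (~` low a)).
  - exact: bigcapT_measurable.
  - exact: measurableC.
  - move=> w wb [C wC]; have [m mC] := nat_upper_bound (C%:R / (c - a)).
    have [n [mn Zn]] := wC m.+1.
    have := wb n I n (leq_trans (ltn0Sn _) mn) (leqnn _).
    apply/negP; rewrite -leNgt (le_trans Zn)//.
    have mnR : m%:R <= n%:R :> R by rewrite ler_nat (leq_trans _ mn).
    have : C%:R <= m%:R * (c - a) by rewrite -ler_pdivrMr// subr_gt0.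
    have : m%:R * (c - a) <= n%:R * (c - a).
      by rewrite ler_wpM2r// subr_ge0 ltW.
    lra.
  - by rewrite [LHS]probability_setC// low1 subee.
have : mu \o bad c @ \oo --> mu (\bigcap_L bad c L).
  apply: nonincreasing_cvg_mu => //.
  - by rewrite (le_lt_trans (probability_le1 _ _))// ltry.
  - exact: bigcapT_measurable.
  - move=> p q pq; apply/subsetPset => w wq l l0 lp.
    by apply: wq => //; exact: leq_trans pq.
rewrite cap0 => /fine_cvg.
move=> /cvgr0Pnorm_lt/(_ _ e0)[L _ Le]; exists L.+1 => //.
by apply: le_lt_trans (Le L.+1 (leqnSn L)); exact: ler_norm.
Qed.

(** By ergodicity [low a] is null or of full measure. In the second case bad times for a rate [c]
    between [a] and [lam] are rare, and integrating [good_times_bound] pushes the mean of [Z n]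
    below [lam * n]. Off [low a], the error [C = 0] gives the claim. *)
Lemma ae_eventually_ge : a < lam ->
  {ae mu, forall w, \forall n \near \oo, a * n%:R <= Z n w}.
Proof.
move=> alam; exists (low a); split => //; last first.
  move=> w /= nw; exists 0%N => m; apply: contrapT => /forallNP nm.
  apply: nw; exists m => // n /= mn; rewrite leNgt; apply/negP => /ltW Zn.
  by apply: (nm n); rewrite addr0.
have [//|low1] := ergS (measurable_low a) (@low_preimage a).
exfalso; pose c := (a + lam) / 2; pose K := M + `|c|.
have ac : a < c by rewrite /c; lra.
have K0 : 0 <= K by rewrite addr_ge0.
(* With this bound on the measure of the bad set, bad times use up at most half of the gap
   [(lam - c) * n]. *)
have e0 : 0 < (lam - c) / (2 * (K + 1)).
  by rewrite divr_gt0//; [rewrite /c|]; lra.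
have [L L0 bL] := bad_small ac low1 e0.
set b := fine _ in bL.
have Zb n : (0 < n)%N -> lam * n%:R <= c * n%:R + K * (n%:R * b + L%:R).
  move=> n0; apply: (le_trans (lamZ n0)).
  pose F w : R := \sum_(0 <= i < n) \1_(bad c L) (iter i S w).
  have iF : mu.-integrable setT (EFin \o F).
    by apply: integrable_sum_nat => i; exact: indic_iter_integrable.
  have ic r : mu.-integrable setT (EFin \o (fun _ : T => r)).
    by apply: bounded_integrable => //; exists `|r|.
  have iF1 : mu.-integrable setT (EFin \o (fun w => F w + L%:R)).
    exact: integrableD iF (ic _).
  have iFL : mu.-integrable setT (EFin \o (fun w => K * (F w + L%:R))).
    rewrite (_ : _ \o _ = fun w => (K%:E * (F w + L%:R)%:E)%E)//.
    exact: integrableZl iF1.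
  have -> : c * n%:R + K * (n%:R * b + L%:R) =
      \int[mu]_w (c * n%:R + K * (F w + L%:R)).
    rewrite (RintegralD _ (ic _) iFL)// (RintegralZl _ _ iF1)//.
    rewrite (RintegralD _ iF (ic _))//.
    rewrite !Rintegral_cst// [fine _](_ : _ = 1) ?mulr1; last first.
      by rewrite [X in fine X]probability_setT.
    rewrite Rintegral_sum_nat//; last by move=> i; exact: indic_iter_integrable.
    under eq_bigr do rewrite Rintegral_indic_iter//.
    by rewrite sumr_const_nat subn0 mulr_natl.
  apply: le_Rintegral => //.
  - exact: bounded_integrable.
  - exact: integrableD (ic _) iFL.
  - move=> w _; apply: good_times_bound => // v nv.
    apply: contrapT => /forallNP nl; apply: nv => l l0 lL.
    by rewrite ltNge; apply/negP => Zl; exact: (nl l).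
(* For such [n] the constant error [K * L] fits in the other half of the gap. *)
have [n nb] := nat_upper_bound (2 * K * L%:R / (lam - c)).
have := Zb n.+1 isT; apply/negP; rewrite -ltNge.
have lc : 0 < lam - c by rewrite /c; lra.
have : 2 * K * L%:R <= n%:R * (lam - c) by rewrite -ler_pdivrMr.
have : b * (2 * (K + 1)) < lam - c by rewrite -ltr_pdivlMr//; lra.
have b0 : 0 <= b by rewrite fine_ge0.
have n1 : n.+1%:R = n%:R + 1 :> R by rewrite -addn1 natrD.
have n10 : 0 < n.+1%:R :> R by [].
rewrite -(ltr_pM2l n10).
nra.
Qed.

End LowerBound.

Lemma Rintegral_iter (f : T -> R) n : measurable_fun setT f ->
  (forall w, 0 <= f w) -> \int[mu]_w f (iter n S w) = \int[mu]_w f w.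
Proof.
move=> mf f0; congr fine.
pose mn := isMeasurableFun.Build _ _ _ _ _ (measurable_iter n).
pose g : {mfun T >-> T} := HB.pack (iter n S) mn.
transitivity (\int[pushforward mu g]_w (f w)%:E)%E.
  rewrite ge0_integral_pushforward//=.
  - exact: measurable_iter.
  - exact/measurable_EFinP.
  - by move=> w _; rewrite lee_fin.
by apply: eq_measure_integral => A mA _; exact: measure_iter.
Qed.

(** * Upper bound and convergence almost everywhere and in mean *)

Section SubadditiveErgodicTheorem.
Variables (X : nat -> T -> R) (M : R).
Hypothesis mX : forall n, measurable_fun setT (X n).
Hypothesis bX : forall n, exists C : R, forall w, `|X n w| <= C.
Hypothesis M0 : 0 <= M.
Hypothesis X0 : forall n w, 0 <= X n w.
Hypothesis subX : forall n m w, (0 < n)%N -> (0 < m)%N ->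
  X (n + m)%N w <= X n w + X m (iter n S w).
Hypothesis XM : forall n w, (0 < n)%N -> X n w <= M * n%:R.

(* Telescoping [U n = X n + ... + X (n + m - 1)] compares [m * X (n + m)] with
   the Birkhoff sum of [X m] itself, so that no average over [S^m] (which need
   not be ergodic) is taken. *)
Lemma subadditive_le_birkhoff m n w : (0 < m)%N -> (0 < n)%N ->
  m%:R * X (n + m)%N w <=
    2 * (m%:R ^+ 2 * M) + \sum_(0 <= i < n) X m (iter i S w).
Proof.
move=> m0 n0; pose U n := \sum_(0 <= r < m) X (n + r)%N w.
have US p : (0 < p)%N -> U p.+1 <= U p + X m (iter p S w).
  (* Both sides are the sum of [X p w, ..., X (p + m) w], with the first or the last term split
     off. *)
  move=> p0; have : X p w + U p.+1 = U p + X (p + m)%N w.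
    have := big_nat_recr m 0 (fun r => X (p + r)%N w) (leq0n m) : _ = U p + _.
    move=> <-; rewrite big_nat_recl// addn0; congr (_ + _).
    by apply: eq_bigr => i _; rewrite addSnnS.
  by have := subX w p0 m0; lra.
have U1 : U 1%N <= m%:R ^+ 2 * M.
  apply: (@le_trans _ _ (\sum_(0 <= r < m) M * m%:R)).
    apply: ler_sum_nat => r /andP[_ rm]; apply: le_trans (XM _ _) _ => //.
    by rewrite ler_wpM2l// ler_nat.
  by rewrite sumr_const_nat subn0 -[leLHS]mulr_natr expr2 mulrC mulrAC mulrA.
have Un p : (0 < p)%N ->
    U p <= m%:R ^+ 2 * M + \sum_(0 <= i < p) X m (iter i S w).
  elim: p => // p IHp _; have [->|p0] := posnP p.
    by rewrite (le_trans U1)// lerDl big_nat1.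
  by rewrite (le_trans (US _ p0))// big_nat_recr//= addrA lerD2r IHp.
(* Each of the [m] copies of [X (n + m) w] is split at time [n + r]; the remaining block of length
   [m - r] costs at most [M * m]. *)
have : m%:R * X (n + m)%N w <= U n + m%:R ^+ 2 * M.
  have -> : m%:R * X (n + m)%N w = \sum_(0 <= r < m) X (n + m)%N w.
    by rewrite sumr_const_nat subn0 mulr_natl.
  have -> : m%:R ^+ 2 * M = \sum_(0 <= r < m) M * m%:R.
    by rewrite sumr_const_nat subn0 -[RHS]mulr_natr; ring.
  rewrite -big_split/=; apply: ler_sum_nat => r /andP[_ rm].
  rewrite -(subnKC (ltnW rm)) addnA (le_trans (subX _ _ _))//.
  - by rewrite addn_gt0 n0.
  - by rewrite subn_gt0.
  rewrite lerD2l (le_trans (XM _ _))// ?subn_gt0// ler_wpM2l//.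
  by rewrite ler_nat subnKC ?leq_subr// ltnW.
by have := Un n n0; lra.
Qed.

(** The negated Birkhoff sums of [X m] are additive, so the lower bound for them is an upper bound
    for the Birkhoff sums, which dominate [m * X n] up to a constant. An intermediate rate [c < b]
    leaves room for that constant. *)
Lemma ae_eventually_le m b : (0 < m)%N -> \int[mu]_w X m w < m%:R * b ->
  {ae mu, forall w, \forall n \near \oo, X n w <= b * n%:R}.
Proof.
move=> m0 Xb; have mR : 0 < m%:R :> R by rewrite ltr0n.
pose c := (\int[mu]_w X m w / m%:R + b) / 2.
have Xmb : \int[mu]_w X m w / m%:R < b by rewrite ltr_pdivrMr// mulrC.
have cb : c < b by rewrite /c; lra.
have Xc : \int[mu]_w X m w < m%:R * c.
  by rewrite mulrC -ltr_pdivrMr// /c; lra.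
have EX0 : 0 <= \int[mu]_w X m w by exact: Rintegral_ge0.
have b0 : 0 <= b by rewrite -(pmulr_rge0 _ mR) (le_trans EX0)// ltW.
pose Z n w := - \sum_(0 <= i < n) X m (iter i S w).
have mXi i : measurable_fun setT (fun w => X m (iter i S w)).
  by apply: measurableT_comp => //; exact: measurable_iter.
have iX i : mu.-integrable setT (EFin \o (fun w => X m (iter i S w))).
  by apply: bounded_integrable => //; have [C XC] := bX m; exists C.
have : {ae mu, forall w, \forall n \near \oo, - (m%:R * c) * n%:R <= Z n w}.
  (* The growth constant is 0 because [Z] is nonpositive. *)
  apply: (@ae_eventually_ge Z 0 (- \int[mu]_w X m w)) => //.
  - by move=> n; apply: measurable_funN; exact: measurable_sum.
  - move=> n; have [C XC] := bX m; exists (\sum_(0 <= i < n) C) => w.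
    rewrite normrN (le_trans (ler_norm_sum _ _ _))// ler_sum//.
  - move=> n p w _ _; rewrite /Z (big_cat_nat (n := n))//= ?leq_addr// opprD lerD2l.
    rewrite -{1}[n]add0n big_addn addKn lerN2 le_eqVlt; apply/orP; left.
    by apply/eqP; apply: eq_bigr => i _; rewrite iterD.
  - by move=> n w _; rewrite mul0r oppr_le0 sumr_ge0.
  - move=> n _; rewrite /Z; under [leRHS]eq_Rintegral do rewrite -mulN1r.
    rewrite (RintegralZl _ _ (integrable_sum_nat n iX))// Rintegral_sum_nat//.
    under eq_bigr do rewrite Rintegral_iter//.
    by rewrite sumr_const_nat subn0 mulN1r mulNr mulr_natr.
  by rewrite ltrN2.
apply: filterS => w [N _ ZN].
have [p pb] := nat_upper_bound (2 * (m%:R * M) / (b - c)).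
exists (maxn N p + m).+1 => // n Nn.
have mn : (m <= n)%N by rewrite (leq_trans (leq_addl _ _) (ltnW Nn)).
have Nnm : (maxn N p < n - m)%N by rewrite ltn_subRL addnC.
have Zn := ZN _ (leq_trans (leq_maxl N p) (ltnW Nnm)).
have nm0 : (0 < n - m)%N by exact: leq_ltn_trans Nnm.
have := subadditive_le_birkhoff w m0 nm0; rewrite subnK// => Xn.
rewrite -(ler_pM2l mR) (le_trans Xn)//.
have nE : n%:R = (n - m)%:R + m%:R :> R by rewrite -natrD subnK.
have pn : p%:R <= (n - m)%:R :> R.
  by rewrite ler_nat (leq_trans (leq_maxr N p) (ltnW Nnm)).
have : 2 * (m%:R * M) <= p%:R * (b - c) by rewrite -ler_pdivrMr// subr_gt0.
have bc0 : 0 < b - c by rewrite subr_gt0.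
have : p%:R * (b - c) <= (n - m)%:R * (b - c) by rewrite ler_wpM2r// ltW.
move=> h1 /le_trans/(_ h1) h2.
have h3 := ler_wpM2l (ltW mR) h2.
have : 0 <= m%:R * (b * m%:R) by rewrite !mulr_ge0.
by move: h3 Zn; rewrite nE /Z; nra.
Qed.

Theorem subadditive_ergodic : exists lam : R,
  [/\ 0 <= lam, {ae mu, forall w, X n w / n%:R @[n --> \oo] --> lam}
    & cvg_L1 mu (fun n w => X n w / n%:R) (fun=> lam)].
Proof.
(* The limit is the infimum of the mean rates: each of them bounds the limsup through
   [ae_eventually_le], and their infimum bounds the liminf. *)
pose D := [set (\int[mu]_w X n.+1 w) / n.+1%:R | n in [set: nat]].
have D0 : lbound D 0.
  by move=> _ [n _ <-]; rewrite divr_ge0// Rintegral_ge0.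
have infD : has_inf D by split; [exists (\int[mu]_w X 1 w / 1), 0%N|exists 0].
pose lam := inf D.
have lam0 : 0 <= lam by apply: lb_le_inf => //; case: infD.
have mXn n : measurable_fun setT (fun w => X n w / n%:R).
  exact: measurable_funM.
have Xlam : {ae mu, forall w, X n w / n%:R @[n --> \oo] --> lam}.
  (* The margins [1 / (p + 1)] are countably many, so one null set serves all of them. *)
  have : {ae mu, forall w (p : nat), \forall n \near \oo,
      (lam - p.+1%:R^-1) * n%:R <= X n w /\ X n w <= (lam + p.+1%:R^-1) * n%:R}.
    apply: ae_foralln => p; have p0 : 0 < p.+1%:R^-1 :> R by rewrite invr_gt0.
    have [_ [n _ <-] Xn] := inf_adherent p0 infD.
    have lower : {ae mu, forall w, \forall n \near \oo,
        (lam - p.+1%:R^-1) * n%:R <= X n w}.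
      apply: (@ae_eventually_ge X M lam) => //; last by rewrite ltrBlDr ltrDl.
      case=> // q _; rewrite -ler_pdivlMr//.
      by apply: ge_inf; [exists 0|exists q].
    have upper : {ae mu, forall w, \forall n \near \oo,
        X n w <= (lam + p.+1%:R^-1) * n%:R}.
      by apply: (@ae_eventually_le n.+1); rewrite // mulrC -ltr_pdivrMr.
    apply: filterS2 lower upper => w wl wu.
    by apply: filterS2 wl wu => q.
  apply: filterS => w wX; apply/cvgrPdist_le => e e0.
  have [p pe] := nat_upper_bound e^-1.
  have pe' : p.+1%:R^-1 <= e.
    rewrite -[leRHS]invrK lef_pV2 ?posrE ?invr_gt0//.
    by rewrite (le_trans pe)// ler_nat.
  have := wX p; apply: filterS2 (nbhs_infty_gt 0) => n n0 [wl wu].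
  have nR : 0 < n%:R :> R by rewrite ltr0n.
  rewrite distrC ler_distl; apply/andP; split.
    by rewrite ler_pdivlMr// (le_trans _ wl)// ler_pM2r// lerD2l lerN2.
  by rewrite ler_pdivrMr// (le_trans wu)// ler_pM2r// lerD2l.
exists lam; split => //.
(* The constant [M] dominates for every [n]: at [n = 0] the quotient is 0, since the inverse of 0 is
   0. *)
have XnM n w : `|X n w / n%:R| <= M.
  rewrite ger0_norm ?divr_ge0//; have [->|n0] := posnP n.
    by rewrite invr0 mulr0.
  by rewrite ler_pdivrMr ?ltr0n// XM.
have icst r : mu.-integrable setT (EFin \o (fun _ : T => r)).
  by apply: bounded_integrable => //; exists `|r|.
have [] := @dominated_convergence _ _ _ mu setT measurableT
  (fun n w => (X n w / n%:R)%:E) (fun=> lam%:E) (fun=> M%:E).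
- by move=> n; apply/measurable_EFinP.
- exact: measurable_cst.
- apply: filterS Xlam => w wX _; apply: cvg_EFin => //.
    by apply: nearW.
- exact: icst.
- by apply: aeW => w n _; rewrite /= lee_fin.
move=> _ cvg0 _; split => //.
by move=> n; apply: bounded_integrable => //; exists M.
Qed.

End SubadditiveErgodicTheorem.

End ErgodicTheorems.

(** * The shift on the boundary *)

Section Shift.
Variables (k : nat) (hk : (2 <= k)%N).
Implicit Types (w : boundary hk) (x y : letter k) (v : free_group k).

Local Notation cyl := (@cylinder k hk).

Definition shift w : boundary hk :=
  @Boundary k hk (fun n => ray w n.+1) (fun n => rayP w n.+1).

Lemma ray_iter_shift n w i : ray (iter n shift w) i = ray w (n + i)%N.
Proof. by elim: n i => // n IHn i; rewrite iterS /= IHn addnS. Qed.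

Lemma foldr_push_cat (s t : seq (letter k)) :
  reduced (s ++ t) -> foldr (@push k) t s = s ++ t.
Proof.
move=> st; rewrite -[RHS]foldr_push_nil// foldr_cat (foldr_push_nil (s := t))//.
move: st; rewrite /reduced; case: s => //= x s; rewrite cat_path => /andP[_].
exact: path_sorted.
Qed.

Lemma mkseqD (f : nat -> letter k) n m :
  mkseq f (n + m) = mkseq f n ++ mkseq (fun i => f (n + i)%N) m.
Proof.
by rewrite /mkseq iotaD map_cat add0n -{2}[n]addn0 iotaDl -map_comp.
Qed.

(** Nothing cancels between consecutive segments of a ray. Applying [phi] and the semi-norm makes
    the process subadditive along the shift. *)
Lemma initialD w n m :
  initial w (n + m) = (initial w n * initial (iter n shift w) m)%g.
Proof.
apply: val_inj; rewrite /= (eq_mkseq (ray_iter_shift n w)).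
rewrite foldr_push_cat -mkseqD//; exact: initial_reduced.
Qed.

Lemma letter_reduced x : reduced [:: x]. Proof. by []. Qed.

Definition fg_letter x : free_group k := FreeGroup (letter_reduced x).

Lemma initial1 w : initial w 1 = fg_letter (ray w 0%N).
Proof. exact: val_inj. Qed.

Lemma fg_letterV x : fg_letter (linv x) = (fg_letter x)^-1%g.
Proof. exact: val_inj. Qed.

Lemma finite_words n : finite_set [set v : free_group k | size v = n].
Proof.
(* Reduced words come from tuples of letters; a tuple that is not reduced is sent to the default
   value [fg_one]. *)
apply: (@sub_finite_set _ _
    ((fun t : n.-tuple (letter k) => insubd (fg_one k) (tval t)) @` setT)).
  move=> v <-; exists (in_tuple v) => //=; apply: val_inj.
  by rewrite val_insubd /= word_reduced.
exact: finite_image.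
Qed.

Lemma measurable_cylinder v : measurable (cyl v).
Proof. by apply: sub_sigma_algebra; exists v. Qed.

Lemma measurable_initial (P : set (free_group k)) n :
  measurable [set w : boundary hk | P (initial w n)].
Proof.
have -> : [set w : boundary hk | P (initial w n)] =
    \bigcup_(v in [set v : free_group k | size v = n] `&` P) cyl v.
  apply/seteqP; split => w.
    move=> Pw; exists (initial w n); first by rewrite /= size_mkseq.
    by rewrite /cylinder /= size_mkseq.
  by move=> [v [/= <- Pv]]; rewrite /cylinder /= => ->.
apply: fin_bigcup_measurable; first exact/finite_setIl/finite_words.
by move=> v _; exact: measurable_cylinder.
Qed.

Lemma measurable_fun_initial d (U : measurableType d) (F : free_group k -> U) n :
  measurable_fun setT (fun w : boundary hk => F (initial w n)).
Proof.
by move=> _ B _; rewrite setTI; exact: (measurable_initial (F @^-1` B)).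
Qed.

Definition first_letter x : set (boundary hk) := [set w | ray w 0%N = x].

Lemma first_letterE x : first_letter x = cyl (fg_letter x).
Proof.
apply/seteqP; split => w; rewrite /cylinder /= initial1; first by move=> ->.
by move=> [].
Qed.

Lemma measurable_first_letter x : measurable (first_letter x).
Proof. by rewrite first_letterE; exact: measurable_cylinder. Qed.

Lemma mkseqS_ray w n : mkseq w n.+1 = ray w 0%N :: mkseq (shift w) n.
Proof. by rewrite -[n.+1]add1n mkseqD. Qed.

Lemma cylinder1 : cyl (fg_one k) = setT.
Proof. by apply/seteqP; split => w // _; exact: val_inj. Qed.

Lemma cylinder_cons x (s : seq (letter k)) (rxs : reduced (x :: s)) (rs : reduced s) :
  cyl (FreeGroup rxs) =
  first_letter x `&` shift @^-1` cyl (FreeGroup rs).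
Proof.
apply/seteqP; split => w; rewrite /cylinder /first_letter /=.
  by move=> /(congr1 val)/=; rewrite mkseqS_ray => -[-> ws]; split => //; exact: val_inj.
move=> [wx /(congr1 val)/= ws]; apply: val_inj => /=.
by rewrite mkseqS_ray wx ws.
Qed.

Lemma cylinder_sub_first_letter x (s : seq (letter k)) (rxs : reduced (x :: s)) :
  cyl (FreeGroup rxs) `<=` first_letter x.
Proof.
by rewrite (cylinder_cons rxs (path_sorted (rxs : path _ _ _))); exact: subIsetl.
Qed.

Lemma measurable_shift : measurable_fun setT shift.
Proof.
apply: (@measurability _ _ _ _ _ _ (range (cyl))) => //.
move=> _ [_ [v _ <-] <-]; rewrite setTI.
(* The preimage of a cylinder depends only on finitely many letters. *)
rewrite (_ : _ @^-1` _ = [set w | behead (initial w (size v).+1) = v]).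
  exact: (measurable_initial (fun u => behead u = v)).
have bE w : behead (mkseq w (size v).+1) = mkseq (shift w) (size v).
  by rewrite mkseqS_ray.
apply/seteqP; split => w wv; first exact: etrans (bE w) (congr1 val wv).
by apply: val_inj; exact: etrans (esym (bE w)) wv.
Qed.

HB.instance Definition _ := isMeasurableFun.Build _ _ _ _ shift measurable_shift.

(** The empty set is added to obtain a pi-system: two cylinders are nested or disjoint. *)
Definition cylinders0 : set (set (boundary hk)) := range (cyl) `|` [set set0].

Lemma cylinders0_generate : (@measurable _ (boundary hk)) = <<s cylinders0 >>.
Proof.
apply/seteqP; split.
  apply: smallest_sub; first exact: smallest_sigma_algebra.
  by move=> A cA; apply: sub_sigma_algebra; left.
apply: smallest_sub; first exact: smallest_sigma_algebra.
move=> A [cA|->]; first exact: sub_sigma_algebra.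
exact: (@measurable0 _ (boundary hk)).
Qed.

Lemma mkseq_take (f : nat -> letter k) m n : (m <= n)%N ->
  take m (mkseq f n) = mkseq f m.
Proof. by move=> mn; rewrite /mkseq -map_take take_iota (minn_idPl mn). Qed.

Lemma cylinders0_setI : setI_closed cylinders0.
Proof.
move=> A B [[u _ <-]|->]; last by right; rewrite set0I.
move=> [[v _ <-]|->]; last by right; rewrite setI0.
wlog uv : u v / (size u <= size v)%N => [hwlog|].
  by case: (leqP (size u) (size v)) => [|/ltnW] uv; [|rewrite setIC]; exact: hwlog.
have cE w : cyl v w -> cyl u w <-> take (size u) v = u.
  rewrite /cylinder /= => /(congr1 val)/= wv; rewrite -[in take _ _]wv mkseq_take//.
  by split => [/(congr1 val)|?] //; exact: val_inj.
have [uE|uE] := pselect (take (size u) v = u :> seq _).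
  left; exists v => //; apply/seteqP; split => w; last by case.
  by move=> wv; split => //; apply/cE.
by right; apply/seteqP; split => // w [wu wv]; apply: uE; exact/(cE w).
Qed.

Lemma eq_measure_cylinder (R : realType) (m1 m2 : {measure set (boundary hk) -> \bar R}) :
  (m1 setT < +oo)%E -> (forall v, m1 (cyl v) = m2 (cyl v)) ->
  forall A, measurable A -> m1 A = m2 A.
Proof.
move=> m1T m12 A mA; apply: (measure_unique cylinders0 (fun=> setT)) => //.
- exact: cylinders0_generate.
- exact: cylinders0_setI.
- by move=> _; left; exists (fg_one k) => //; exact: cylinder1.
- by apply/seteqP; split => // w _; exists 0%N.
- by move=> B [[v _ <-]|->]; [exact: m12|rewrite !measure0].
Qed.

End Shift.

Lemma double_sub1_gt1 (R : realType) k : (2 <= k)%N -> 1 < 2 * k%:R - 1 :> R.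
Proof. by move=> k2; have : 2 <= k%:R :> R; [rewrite ler_nat|lra]. Qed.

Lemma sum_letters_cst (R : realType) k (c : R) :
  \sum_(x : letter k) c = 2 * k%:R * c.
Proof.
by rewrite sumr_const card_prod card_ord card_bool -[LHS]mulr_natr natrM; ring.
Qed.

Lemma sum_reindex_linv (R : realType) k (F : letter k -> R) :
  \sum_x F (linv x) = \sum_x F x.
Proof.
rewrite [RHS](reindex (@linv k))//; apply: onW_bij.
by exists (@linv k); exact: linvK.
Qed.

(** * Invariance and ergodicity of the uniform measure under the shift *)

Section UniformMeasure.
Variables (R : realType) (k : nat) (hk : (2 <= k)%N).
Variable mu : probability (boundary hk) R.
Hypothesis hmu : is_uniform_measure mu.
Implicit Types (x y : letter k) (v : free_group k) (A B : set (boundary hk)).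

Local Notation shift := (@shift k hk).
Local Notation first_letter := (@first_letter k hk).
Local Notation cyl := (@cylinder k hk).
Local Notation q := (2 * k%:R - 1 : R).
Local Notation Pr A := (fine (mu A)).

Let q_gt1 : 1 < q. Proof. exact: double_sub1_gt1. Qed.

Let k_gt0 : 0 < k%:R :> R. Proof. by have := q_gt1; lra. Qed.
Let q_gt0 : 0 < q. Proof. by have := q_gt1; lra. Qed.

Let muE A : measurable A -> mu A = (Pr A)%:E.
Proof. by move=> mA; rewrite fineK// fin_num_measure. Qed.

Let measurable_preshift A : measurable A -> measurable (shift @^-1` A).
Proof. by move=> mA; rewrite -[X in measurable X]setTI; exact: measurable_shift. Qed.

Let mL := @measurable_first_letter k hk.
Local Hint Resolve mL measurable_preshift : core.

Lemma PrD A B : measurable A -> measurable B -> Pr (A `\` B) = Pr A - Pr (A `&` B).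
Proof.
move=> mA mB; rewrite measureD//; last by rewrite [ltLHS]muE ?ltry.
by rewrite fineB// fin_num_measure//; exact: measurableI.
Qed.

Lemma Pr_first_letters A : measurable A -> Pr A = \sum_x Pr (A `&` first_letter x).
Proof.
move=> mA; have {1}-> : A = \bigcup_(x in [set: letter k]) (A `&` first_letter x).
  apply/seteqP; split => [w Aw|w [x _ []]//].
  by exists (ray w 0%N).
rewrite measure_fin_bigcup//=; last 2 first.
- by move=> x y _ _ [w [[_ <-] [_ <-]]].
- by move=> x _; exact: measurableI.
have -> : [set: letter k] = [set` index_enum (letter k)].
  by apply/seteqP; split => x //= _; rewrite mem_index_enum.
rewrite -fsbig_seq ?index_enum_uniq//.
under eq_bigr => x _ do rewrite (muE (measurableI _ _ mA (mL x))).
by rewrite sumEFin.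
Qed.

Lemma Pr_cylinder v n : size v = n.+1 -> Pr (cyl v) = (2 * k%:R * q ^+ n)^-1.
Proof.
move=> vn; rewrite hmu ?vn ?subn1//= => v1.
by move: vn; rewrite v1.
Qed.

Lemma Pr_first_letter x : Pr (first_letter x) = (2 * k%:R)^-1.
Proof. by rewrite first_letterE (@Pr_cylinder _ 0)// expr0 mulr1. Qed.

Let Pr_setT : Pr setT = 1.
Proof. by rewrite [X in fine X]probability_setT. Qed.

(** If [v] begins with [linv x], both sides vanish. If not and [v] is nonempty, prefixing [x] gives
    a reduced word one letter longer, which divides the mass by [q]. The empty word is a direct
    computation. *)
Lemma markov_cylinder x v :
  Pr (first_letter x `&` shift @^-1` cyl v) =
  q^-1 * Pr (cyl v `\` first_letter (linv x)).
Proof.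
case: v => [[|y s] rs].
  have -> : FreeGroup rs = fg_one k by exact: val_inj.
  rewrite cylinder1 preimage_setT setIT PrD// setTI Pr_setT !Pr_first_letter.
  by field; have := q_gt1; have := k_gt0; rewrite !lt0r => /andP[-> _]; lra.
have yL := @cylinder_sub_first_letter k hk _ _ rs.
have [yx|yx] := eqVneq y (linv x).
  rewrite (_ : _ `&` _ = set0); last first.
    apply/seteqP; split => // w [wx /yL wy]; have := rayP w 0.
    by rewrite wx -yx -wy eqxx.
  rewrite (_ : _ `\` _ = set0) ?measure0 ?mulr0//.
  by apply/seteqP; split => // w [/yL wy]; rewrite -yx.
have rxs : reduced (x :: y :: s) by rewrite /reduced/= yx.
rewrite -(cylinder_cons hk rxs rs) (@Pr_cylinder _ (size s).+1)//.
rewrite (_ : _ `\` _ = cyl (FreeGroup rs)); last first.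
  apply/seteqP; split => [w []//|w wy]; split => //.
  by rewrite /first_letter/= (yL _ wy); exact/eqP.
by rewrite (@Pr_cylinder _ (size s))// exprS mulrCA invfM.
Qed.

(* Given its first letter [x], the tail of a random ray is a random ray
   conditioned not to begin with [x^-1]. *)
Lemma markov x B : measurable B ->
  Pr (first_letter x `&` shift @^-1` B) = q^-1 * Pr (B `\` first_letter (linv x)).
Proof.
have q0 : 0 <= q^-1 by rewrite invr_ge0 ltW.
have mC : measurable (~` first_letter (linv x)) by exact: measurableC.
(* Both sides are finite measures in [B], so it suffices to compare them on cylinders. *)
pose m1 := pushforward (mrestr mu (mL x)) shift.
pose m2 := mscale (NngNum q0) (mrestr mu mC).
have m1E A : fine (m1 A) = Pr (first_letter x `&` shift @^-1` A).
  by rewrite /m1 /pushforward /mrestr setIC.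
have m2E A : measurable A -> fine (m2 A) = q^-1 * Pr (A `\` first_letter (linv x)).
  by move=> mA; rewrite /m2 /mscale /mrestr /= fineM// fin_num_measure.
move=> mB; rewrite -m1E -m2E//; congr fine; move: B mB.
apply: eq_measure_cylinder => [|v].
  rewrite /m1 /pushforward /mrestr /= [ltLHS]muE ?ltry//.
  by apply: measurableI => //; exact: measurable_preshift.
have mv := @measurable_cylinder k hk v.
suff : fine (m1 (cyl v)) = fine (m2 (cyl v)).
  have f1 : m1 (cyl v) \is a fin_num.
    rewrite /m1 /pushforward /mrestr fin_num_measure//.
    by apply: measurableI => //; exact: measurable_preshift.
  have f2 : m2 (cyl v) \is a fin_num.
    by rewrite /m2 /mscale /mrestr fin_numM// fin_num_measure//.
  by move=> m12; exact: etrans (esym (fineK f1)) (etrans (congr1 EFin m12) (fineK f2)).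
by rewrite m1E m2E// markov_cylinder.
Qed.

(** Summing [markov] over the [2k] letters gives [q^-1 * (2k * Pr A - Pr A)], and [q = 2k - 1]. *)
Lemma shift_preserving A : measurable A -> mu (shift @^-1` A) = mu A.
Proof.
move=> mA; rewrite muE//; last exact: measurable_preshift.
rewrite [RHS]muE//; congr EFin.
rewrite Pr_first_letters; last exact: measurable_preshift.
under eq_bigr => x _ do rewrite setIC markov// PrD//.
rewrite -mulr_sumr sumrB sum_letters_cst.
rewrite (sum_reindex_linv (fun x => Pr (A `&` first_letter x))).
rewrite -Pr_first_letters//.
by field; have := q_gt1; lra.
Qed.

Lemma shift_ergodic A : measurable A -> shift @^-1` A `<=` A ->
  mu A = 0%E \/ mu A = 1%E.
Proof.
move=> mA sA; have mSA := measurable_preshift mA.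
(* The inclusion and the equality of measures make [A] invariant up to a null set. *)
have null : mu (A `\` shift @^-1` A) = 0%E.
  rewrite muE; last exact: measurableD.
  by rewrite PrD// (setIidr sA) shift_preserving// subrr.
have PrSA B : measurable B -> Pr (B `&` A) = Pr (B `&` shift @^-1` A).
  move=> mB; have mBA := measurableI _ _ mB mA.
  have : Pr (B `&` A `\` shift @^-1` A) = 0.
    rewrite (_ : mu _ = 0%E)//; apply: subset_measure0 null => //.
    - exact: measurableD.
    - exact: measurableD.
    - by move=> w [[_ Aw] nw].
  rewrite PrD// -setIA (setIidr sA); lra.
pose h x := Pr (first_letter x `&` A).
have hE x : h x = q^-1 * (Pr A - h (linv x)).
  by rewrite /h PrSA// markov// PrD// [A `&` _]setIC.
(* The equation [hE] at [x] and at [linv x] is a 2 by 2 system; since [q] differs from 1, it forces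
   [h x = h (linv x)]. *)
have hc x : h x = Pr A / (2 * k%:R).
  have := hE x; have := hE (linv x); rewrite linvK => h1 h2.
  have h1' : q * h (linv x) = Pr A - h x by rewrite h1 mulVKf// gt_eqF.
  have h2' : q * h x = Pr A - h (linv x) by rewrite h2 mulVKf// gt_eqF.
  have hh : h (linv x) = h x.
    have : (q - 1) * (h x - h (linv x)) = 0 by lra.
    by move=> /eqP; rewrite mulf_eq0 subr_eq0 (gt_eqF q_gt1)/= subr_eq0 => /eqP.
  rewrite hh in h2'.
  have -> : Pr A = 2 * k%:R * h x by lra.
  by rewrite mulrC mulKf// gt_eqF// mulr_gt0.
(* Independence goes by induction on the word: [markov] strips the first letter, and the second
   letter, not being [linv x], makes the removed part empty. *)
have cylA v : Pr (cyl v `&` A) = Pr A * Pr (cyl v).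
  case: v => s; elim: s => [|x s IHs] rs.
    have -> : FreeGroup rs = fg_one k by exact: val_inj.
    by rewrite cylinder1 setTI Pr_setT mulr1.
  case: s IHs rs => [|y s] IHs rs.
    have -> : FreeGroup rs = fg_letter x by exact: val_inj.
    by rewrite -first_letterE -/(h x) hc Pr_first_letter.
  have rys : reduced (y :: s) by case/andP: rs.
  have mys := @measurable_cylinder k hk (FreeGroup rys).
  rewrite PrSA; last exact: measurable_cylinder.
  rewrite (cylinder_cons hk rs rys) -setIA -preimage_setI.
  rewrite !markov//; last exact: measurableI.
  have yx : y != linv x by case/andP: rs.
  have subL : cyl (FreeGroup rys) `&` first_letter (linv x) = set0.
    apply/seteqP; split => // w [/cylinder_sub_first_letter wy wx].
    by move: yx; rewrite -wy -wx eqxx.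
  rewrite !PrD//; last exact: measurableI.
  by rewrite setIAC subL set0I measure0/= !subr0 IHs mulrCA.
have PrA0 : 0 <= Pr A by rewrite fine_ge0.
(* Two measures that agree on cylinders, the restriction of [mu] to [A] and [Pr A * mu], are
   evaluated at [A] itself. *)
have : Pr A = Pr A * Pr A.
  suff eqA : mrestr mu mA A = mscale (NngNum PrA0) mu A.
    transitivity (fine (mrestr mu mA A)); first by rewrite /mrestr setIid.
    by rewrite eqA /mscale/= fineM// fin_num_measure.
  apply: (@eq_measure_cylinder k hk R (mrestr mu mA) (mscale (NngNum PrA0) mu)) => //.
    by rewrite /= /mrestr setTI muE ?ltry.
  move=> v; have mv := @measurable_cylinder k hk v.
  rewrite /= /mrestr /mscale muE; last exact: measurableI.
  by rewrite cylA EFinM -!muE.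
move=> /eqP; rewrite -subr_eq0 -{1}[Pr A]mulr1 -mulrBr mulf_eq0 subr_eq0.
by move=> /orP[/eqP PA|/eqP PA]; [left|right]; rewrite (muE mA) -?PA// PA.
Qed.

End UniformMeasure.

(** * Non-backtracking walks and amenability *)

Section FinitelySupportedFunctions.
Variables (R : realType) (G : groupType).
Implicit Types (f g : G -> R) (a : G).

Definition fsupp f := finite_set [set h | f h != 0].
(** By convention this sum is 0 when the support is infinite, hence the hypotheses [fsupp] below. *)
Definition gsum f : R := \sum_(h \in [set: G]) f h.
Definition nsq f : R := gsum (fun h => f h ^+ 2).
Definition translate a f : G -> R := fun h => f (a^-1 * h)%g.

Lemma fsupp_sub f g : (forall h, f h = 0 -> g h = 0) -> fsupp f -> fsupp g.
Proof. by move=> fg; apply: sub_finite_set => h /=; apply: contraNneq => /fg ->. Qed.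

Lemma fsupp_op (op : R -> R -> R) f g : op 0 0 = 0 ->
  fsupp f -> fsupp g -> fsupp (fun h => op (f h) (g h)).
Proof.
move=> op0 ff fg; apply: (@sub_finite_set _ _ ([set h | f h != 0] `|` [set h | g h != 0])).
  move=> h /=; have [->|] := eqVneq (f h) 0; last by left.
  by have [->|] := eqVneq (g h) 0; [rewrite op0 eqxx|right].
by rewrite finite_setU.
Qed.

Lemma fsuppD f g : fsupp f -> fsupp g -> fsupp (fun h => f h + g h).
Proof. by apply: (@fsupp_op +%R); rewrite addr0. Qed.

Lemma fsuppB f g : fsupp f -> fsupp g -> fsupp (fun h => f h - g h).
Proof. by apply: (@fsupp_op (fun x y => x - y)); rewrite subr0. Qed.

Lemma fsuppZ c f : fsupp f -> fsupp (fun h => c * f h).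
Proof. by apply: fsupp_sub => h ->; rewrite mulr0. Qed.

Lemma fsupp_sq f : fsupp f -> fsupp (fun h => f h ^+ 2).
Proof. by apply: fsupp_sub => h ->; rewrite expr0n. Qed.

Lemma fsupp_norm f : fsupp f -> fsupp (fun h => `|f h|).
Proof. by apply: fsupp_sub => h ->; rewrite normr0. Qed.

Lemma fsupp_sum (I : Type) (r : seq I) (P : pred I) (F : I -> G -> R) :
  (forall i, fsupp (F i)) -> fsupp (fun h => \sum_(i <- r | P i) F i h).
Proof.
move=> fF; elim: r => [|i r IHr].
  apply: (@sub_finite_set _ _ set0) => // h /=.
  by rewrite big_nil eqxx.
(* With absolute values, a vanishing sum forces both terms to vanish. *)
apply: fsupp_sub (fsuppD (fsupp_norm (fF i)) (fsupp_norm IHr)) => h /eqP.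
rewrite paddr_eq0// !normr_eq0 big_cons => /andP[/eqP -> /eqP ->].
by rewrite addr0 if_same.
Qed.

Lemma fsupp_translate a f : fsupp f -> fsupp (translate a f).
Proof.
move=> ff; apply: (@sub_finite_set _ _ ((fun h => a * h)%g @` [set h | f h != 0])).
  by move=> h /= fh; exists (a^-1 * h)%g => //; rewrite mulKVg.
exact: finite_image.
Qed.

Lemma gsumE f (A : set G) : finite_set A -> [set h | f h != 0] `<=` A ->
  gsum f = \sum_(h <- fset_set A) f h.
Proof.
move=> fA sA; rewrite -fsbig_finite//; apply/esym/fsbig_widen => // h [_ /= nA].
by apply: contra_notP nA => fh; apply: sA; apply/eqP.
Qed.

Lemma gsumD f g : fsupp f -> fsupp g ->
  gsum (fun h => f h + g h) = gsum f + gsum g.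
Proof.
move=> ff fg; pose A := [set h | f h != 0] `|` [set h | g h != 0].
have fA : finite_set A by rewrite finite_setU.
rewrite !(gsumE fA) ?big_split//; first exact: subsetUr.
  exact: subsetUl.
move=> h /=; have [->|] := eqVneq (f h) 0; last by left.
by have [->|] := eqVneq (g h) 0; [rewrite addr0 eqxx|right].
Qed.

Lemma gsumZ c f : gsum (fun h => c * f h) = c * gsum f.
Proof. by rewrite /gsum mulr_fsumr. Qed.

Lemma gsumB f g : fsupp f -> fsupp g ->
  gsum (fun h => f h - g h) = gsum f - gsum g.
Proof.
move=> ff fg; rewrite -[- gsum g]mulN1r -gsumZ -gsumD//; last exact: fsuppZ.
by apply: eq_fsbigr => h _; rewrite mulN1r.
Qed.

Lemma eq_gsum f g : f =1 g -> gsum f = gsum g.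
Proof. by move=> fg; apply: eq_fsbigr => h _; exact: fg. Qed.

Lemma gsum0 : gsum (fun=> 0) = 0.
Proof. by apply: fsbig1. Qed.

Lemma gsum_ge0 f : (forall h, 0 <= f h) -> 0 <= gsum f.
Proof. by move=> f0; apply: fsumr_ge0. Qed.

Lemma ler_gsum f g : fsupp f -> fsupp g -> (forall h, f h <= g h) -> gsum f <= gsum g.
Proof.
by move=> ff fg fg'; rewrite -subr_ge0 -gsumB// gsum_ge0// => h; rewrite subr_ge0.
Qed.

Lemma gsum_sum (I : Type) (r : seq I) (P : pred I) (F : I -> G -> R) :
  (forall i, fsupp (F i)) ->
  gsum (fun h => \sum_(i <- r | P i) F i h) = \sum_(i <- r | P i) gsum (F i).
Proof.
move=> fF; elim: r => [|i r IHr].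
  by rewrite big_nil -[RHS]gsum0; apply: eq_gsum => h; rewrite big_nil.
rewrite big_cons -IHr; case: ifP => Pi.
  by rewrite -gsumD//; [apply: eq_gsum => h; rewrite big_cons Pi|exact: fsupp_sum].
by apply: eq_gsum => h; rewrite big_cons Pi.
Qed.

Lemma mulg_bij a : bijective (fun h : G => (a * h)%g).
Proof. by exists (fun h => a^-1 * h)%g => h; rewrite (mulKg, mulKVg). Qed.

Lemma gsum_translate a f : gsum (translate a f) = gsum f.
Proof. by rewrite [RHS](reindex_fsbigT _ _ (mulg_bij a^-1)). Qed.

Lemma ler_norm_gsum f : fsupp f -> `|gsum f| <= gsum (fun h => `|f h|).
Proof.
move=> ff; rewrite !(gsumE ff) ?ler_norm_sum// => h /=.
by rewrite normr_eq0.
Qed.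

Lemma nsq_ge0 f : 0 <= nsq f.
Proof. by apply: gsum_ge0 => h; rewrite sqr_ge0. Qed.

Lemma nsq_translate a f : nsq (translate a f) = nsq f.
Proof. exact: (gsum_translate a (fun h => f h ^+ 2)). Qed.

Lemma nsqZ c f : nsq (fun h => c * f h) = c ^+ 2 * nsq f.
Proof. by rewrite -gsumZ; apply: eq_gsum => h; rewrite exprMn. Qed.

Lemma nsqD_le f g : fsupp f -> fsupp g ->
  nsq (fun h => f h + g h) <= 2 * (nsq f + nsq g).
Proof.
move=> ff fg; have [sf sg] := (fsupp_sq ff, fsupp_sq fg).
rewrite -gsumD// -gsumZ; apply: ler_gsum.
- exact/fsupp_sq/fsuppD.
- exact/fsuppZ/fsuppD.
- by move=> h; have := sqr_ge0 (f h - g h); rewrite !expr2; lra.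
Qed.

Lemma nsqD3_le f g u : fsupp f -> fsupp g -> fsupp u ->
  nsq (fun h => f h + g h + u h) <= 3 * (nsq f + nsq g + nsq u).
Proof.
move=> ff fg fu; have [[sf sg] su] := (fsupp_sq ff, fsupp_sq fg, fsupp_sq fu).
rewrite -!gsumD//; last exact: fsuppD.
rewrite -gsumZ; apply: ler_gsum.
- by apply: fsupp_sq; apply: fsuppD => //; exact: fsuppD.
- by apply: fsuppZ; apply: fsuppD => //; exact: fsuppD.
- move=> h; have := sqr_ge0 (f h - g h); have := sqr_ge0 (f h - u h).
  by have := sqr_ge0 (g h - u h); rewrite !expr2; lra.
Qed.

Lemma nsq_sym f g : nsq (fun h => f h - g h) = nsq (fun h => g h - f h).
Proof. by apply: eq_gsum => h; rewrite -sqrrN opprB. Qed.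

End FinitelySupportedFunctions.

(** * Energy loss of the non-backtracking walk *)

Section NonBacktrackingEnergy.
Variables (R : realType) (G : groupType) (k : nat) (psi : letter k -> G).
Hypothesis k2 : (2 <= k)%N.
Hypothesis psiV : forall x, psi (linv x) = (psi x)^-1%g.
Implicit Types (v : letter k -> G -> R) (x y z : letter k).

Local Notation q := (2 * k%:R - 1 : R).
Local Notation dist f g := (nsq (fun h => f h - g h)).

(* One step of the non-backtracking walk: [v x h] is the mass of the paths with
   first letter [x] that end at [h]. *)
Definition nb_step v x : G -> R :=
  translate (psi x) (fun h => q^-1 * \sum_(y | y != linv x) v y h).

Definition energy v : R := \sum_x nsq (v x).

Let q_gt1 : 1 < q. Proof. exact: double_sub1_gt1. Qed.

Let q_gt0 : 0 < q. Proof. by have := q_gt1; lra. Qed.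

Let q0 : q != 0. Proof. by rewrite gt_eqF. Qed.

Lemma sum_neq_letter z (c : R) : \sum_(y | y != z) c = q * c.
Proof.
have := sum_letters_cst k c; rewrite (bigD1 z)//=; lra.
Qed.

(** Lagrange's identity with unit weights: it gives the exact defect in Cauchy-Schwarz. *)
Lemma sq_sum_pairs (I : finType) (P : pred I) (a : I -> R) :
  \sum_(i | P i) \sum_(j | P j) (a i - a j) ^+ 2 =
  2 * ((\sum_(i | P i) 1) * \sum_(i | P i) a i ^+ 2 - (\sum_(i | P i) a i) ^+ 2).
Proof.
set c : R := \sum_(i | P i) 1; set s := \sum_(i | P i) a i.
set t := \sum_(i | P i) a i ^+ 2.
have inner i : \sum_(j | P j) (a i - a j) ^+ 2 = a i ^+ 2 * c + t - 2 * (a i * s).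
  rewrite /c /t /s !mulr_sumr -big_split -sumrB /=.
  by apply: eq_bigr => j _; ring.
under eq_bigr do rewrite inner.
rewrite sumrB big_split/= -mulr_suml -mulr_sumr -mulr_suml -/s -/t.
rewrite (_ : \sum_(i | P i) t = c * t); first by ring.
by rewrite /c mulr_suml; apply: eq_bigr => i _; rewrite mul1r.
Qed.

Lemma fsupp_nb_step v x : (forall y, fsupp (v y)) -> fsupp (nb_step v x).
Proof. by move=> fv; apply/fsupp_translate/fsuppZ/fsupp_sum. Qed.

(** Translation preserves the norm, and [sq_sum_pairs] over the [q] letters other than [linv x]
    computes pointwise what averaging loses. *)
Lemma nsq_nb_step v x : (forall y, fsupp (v y)) ->
  nsq (nb_step v x) = q^-1 * \sum_(y | y != linv x) nsq (v y) -
    (2 * q ^+ 2)^-1 * \sum_(y | y != linv x) \sum_(z | z != linv x) dist (v y) (v z).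
Proof.
move=> fv; rewrite nsq_translate nsqZ.
have fv2 y := fsupp_sq (fv y).
have fd y z : fsupp (fun h => (v y h - v z h) ^+ 2) by apply/fsupp_sq/fsuppB.
under [in X in _ - _ * X]eq_bigr => y _ do rewrite -gsum_sum//.
have fd' y : fsupp (fun h => \sum_(z | z != linv x) (v y h - v z h) ^+ 2).
  exact: fsupp_sum.
rewrite -!gsum_sum// -!gsumZ -gsumB; last 2 first.
- exact/fsuppZ/fsupp_sum.
- exact/fsuppZ/fsupp_sum.
apply: eq_gsum => h; rewrite sq_sum_pairs sum_neq_letter.
by field; rewrite q0.
Qed.

(** Each [y] occurs in the averages of exactly [q] letters [x], so the main terms of [nsq_nb_step]
    add up to [energy v]. *)
Lemma energy_loss v : (forall y, fsupp (v y)) ->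
  energy v - energy (nb_step v) = (2 * q ^+ 2)^-1 *
    \sum_x \sum_(y | y != linv x) \sum_(z | z != linv x) dist (v y) (v z).
Proof.
move=> fv; rewrite /energy; under [X in _ - X]eq_bigr do rewrite nsq_nb_step//.
rewrite [X in _ - X]sumrB -!mulr_sumr.
suff -> : \sum_x \sum_(y | y != linv x) nsq (v y) = q * \sum_y nsq (v y).
  by rewrite mulKf// opprB addrC subrK.
rewrite (sum_reindex_linv (fun x => \sum_(y | y != x) nsq (v y))).
rewrite (exchange_big_dep predT)//= mulr_sumr; apply: eq_bigr => y _.
by under eq_bigl do rewrite eq_sym; rewrite sum_neq_letter.
Qed.

Lemma energy_nb_step_le v : (forall y, fsupp (v y)) -> energy (nb_step v) <= energy v.
Proof.
move=> fv; rewrite -subr_ge0 energy_loss// mulr_ge0//.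
  by rewrite invr_ge0 mulr_ge0// sqr_ge0.
by do 3 (apply: sumr_ge0 => ? _); exact: nsq_ge0.
Qed.

Lemma dist_le_loss v y z : (forall x, fsupp (v x)) ->
  dist (v y) (v z) <= 2 * q ^+ 2 * (energy v - energy (nb_step v)).
Proof.
move=> fv; rewrite energy_loss// mulVKf; last first.
  by rewrite gt_eqF// mulr_gt0// exprn_gt0.
(* There are at least four letters, so one has an inverse outside [{y, z}]; the distance is then one
   of the nonnegative terms of the loss. *)
have [x /andP[yx zx]] : exists x, (y != linv x) && (z != linv x).
  have : (#|pred2 y z| < #|{: letter k}|)%N.
    by rewrite card2 card_prod card_ord card_bool; have := k2; case: (y != z); lia.
  rewrite ltnNge => /negP nc; apply: contrapT => /forallNP nx; apply: nc.
  apply: subset_leq_card. apply/fintype.subsetP => u _; rewrite inE.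
  have := nx (linv u); rewrite linvK => /negP; rewrite negb_and !negbK.
  by rewrite ![_ == u]eq_sym.
rewrite (bigD1 x)//= (bigD1 y)//= (bigD1 z)//= -!addrA lerDl.
by rewrite !addr_ge0//; do ?[exact: nsq_ge0 | apply: sumr_ge0 => ? _].
Qed.

Lemma jensen_neq_letter z (a : letter k -> R) :
  (q^-1 * \sum_(y | y != z) a y) ^+ 2 <= q^-1 * \sum_(y | y != z) a y ^+ 2.
Proof.
have : 0 <= \sum_(i | i != z) \sum_(j | j != z) (a i - a j) ^+ 2.
  by apply: sumr_ge0 => i _; apply: sumr_ge0 => j _; exact: sqr_ge0.
rewrite sq_sum_pairs sum_neq_letter mulr1 pmulr_rge0// subr_ge0 => le_s.
rewrite exprMn expr2 -mulrA ler_pM2l ?invr_gt0//.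
by rewrite mulrC ler_pdivrMr// [leRHS]mulrC.
Qed.

Section AlmostInvariantVector.
Variables (v : letter k -> G -> R) (z : letter k) (eta : R).
Hypothesis fv : forall y, fsupp (v y).
Hypothesis v0 : forall y h, 0 <= v y h.
Hypothesis eta0 : 0 <= eta.
Hypothesis eta_small : 16 * k%:R * q ^+ 2 * eta <= 1.
Hypothesis loss : energy v - energy (nb_step (nb_step v)) <= eta * energy v.

(** The bound of [dist_le_loss] for either of the two steps, since each loses at most the total. *)
Let D := 2 * q ^+ 2 * (eta * energy v).
Let fv' x : fsupp (nb_step v x). Proof. exact: fsupp_nb_step. Qed.
Let ft x : fsupp (translate (psi x) (v z)). Proof. exact: fsupp_translate. Qed.

Let dist_v y y' : dist (v y) (v y') <= D.
Proof.
apply: le_trans (dist_le_loss _ _ fv) _.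
rewrite ler_pM2l ?mulr_gt0 ?exprn_gt0// (le_trans _ loss)// lerD2l lerN2.
exact: energy_nb_step_le.
Qed.

Let dist_step x y : dist (nb_step v x) (nb_step v y) <= D.
Proof.
apply: le_trans (dist_le_loss _ _ fv') _.
rewrite ler_pM2l ?mulr_gt0 ?exprn_gt0// (le_trans _ loss)// lerD2r.
exact: energy_nb_step_le.
Qed.

(** Up to translation by [psi x], the difference is the average of the [v y - v z], each small by
    [dist_v]; Jensen's inequality concludes. *)
Let dist_step_translate x : dist (nb_step v x) (translate (psi x) (v z)) <= D.
Proof.
pose u h := q^-1 * \sum_(y | y != linv x) (v y h - v z h).
have fd y : fsupp (fun h => v y h - v z h) by exact: fsuppB.
have fd2 y := fsupp_sq (fd y).
have -> : dist (nb_step v x) (translate (psi x) (v z)) = nsq (translate (psi x) u).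
  apply: eq_gsum => h; congr (_ ^+ 2); rewrite /nb_step /translate /u.
  by rewrite sumrB sum_neq_letter mulrBr mulKf.
rewrite nsq_translate.
apply: (@le_trans _ _ (gsum (fun h => q^-1 * \sum_(y | y != linv x) (v y h - v z h) ^+ 2))).
  apply: ler_gsum => [||h]; last exact: jensen_neq_letter.
  - exact/fsupp_sq/fsuppZ/fsupp_sum.
  - exact/fsuppZ/fsupp_sum.
rewrite gsumZ gsum_sum// mulrC ler_pdivrMr// mulrC -(sum_neq_letter (linv x)).
by apply: ler_sum => y _; exact: dist_v.
Qed.

(** The triangle inequality through [nb_step v x] and [nb_step v y]: three squared distances [D],
    times 3. *)
Let dist_translates x y :
  dist (translate (psi x) (v z)) (translate (psi y) (v z)) <= 9 * D.
Proof.
have -> : dist (translate (psi x) (v z)) (translate (psi y) (v z)) =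
  nsq (fun h => (translate (psi x) (v z) h - nb_step v x h) +
    (nb_step v x h - nb_step v y h) + (nb_step v y h - translate (psi y) (v z) h)).
  by apply: eq_gsum => h; congr (_ ^+ 2); ring.
apply: le_trans (nsqD3_le _ _ _) _; try exact: fsuppB.
have := dist_step_translate x; rewrite nsq_sym.
have := dist_step_translate y; have := dist_step x y.
by move=> h1 h2 h3; lra.
Qed.

(** All components are close to [v z], and [eta_small] makes the total error at most half of the
    energy. *)
Lemma energy_le_nsq : energy v <= 8 * k%:R * nsq (v z).
Proof.
have : energy v <= 2 * k%:R * (2 * (nsq (v z) + D)).
  rewrite -sum_letters_cst; apply: ler_sum => y _.
  have -> : nsq (v y) = nsq (fun h => v z h + (v y h - v z h)).
    by apply: eq_gsum => h; rewrite addrC subrK.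
  apply: le_trans (nsqD_le _ _) _ => //; first exact: fsuppB.
  by rewrite ler_pM2l// lerD2l dist_v.
have E0 : 0 <= energy v by apply: sumr_ge0 => y _; exact: nsq_ge0.
have := ler_wpM2r E0 eta_small; rewrite mul1r.
by rewrite /D; lra.
Qed.

(* [x v] is close to [z v] for every letter [x], but not to [v] itself (think of
   a bipartite Cayley graph); adding the two makes the vector almost invariant. *)
Definition almost_inv : G -> R := fun h => v z h + translate (psi z) (v z) h.

Lemma fsupp_almost_inv : fsupp almost_inv.
Proof. exact: fsuppD. Qed.

Lemma nsq_le_almost_inv : nsq (v z) <= nsq almost_inv.
Proof.
apply: ler_gsum => [||h]; try exact/fsupp_sq.
  exact/fsupp_sq/fsupp_almost_inv.
by rewrite ler_pXn2r ?nnegrE ?addr_ge0// ?lerDl ?v0//; exact: v0.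
Qed.

Lemma dist_almost_inv x :
  dist (translate (psi x) almost_inv) almost_inv <=
  576 * k%:R * q ^+ 2 * eta * nsq almost_inv.
Proof.
(* With [v] for [v z]: [x(v + zv) - (v + zv) = (xv - zv) + x(zv - x^-1 v)]. Two squared distances
   [9 * D], doubled, give [36 * D]; the bound [DE] contributes the factor 16. *)
have -> : dist (translate (psi x) almost_inv) almost_inv =
  nsq (fun h => (translate (psi x) (v z) h - translate (psi z) (v z) h) +
    translate (psi x) (fun h => translate (psi z) (v z) h -
      translate (psi (linv x)) (v z) h) h).
  apply: eq_gsum => h; congr (_ ^+ 2); rewrite /almost_inv /translate psiV.
  by rewrite invgK mulKVg; ring.
apply: le_trans (nsqD_le _ _) _.
- exact: fsuppB.
- by apply: fsupp_translate; exact: fsuppB.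
rewrite nsq_translate.
have q2 : 0 <= q ^+ 2 * eta by rewrite mulr_ge0// sqr_ge0.
have DE : D <= 16 * k%:R * (q ^+ 2 * eta) * nsq almost_inv.
  rewrite /D; have := ler_wpM2l q2 energy_le_nsq.
  have := ler_wpM2l q2 nsq_le_almost_inv.
  move=> /(ler_wpM2l (ler0n R k)); lra.
have := dist_translates x z; have := dist_translates z (linv x).
move=> h1 h2; lra.
Qed.

End AlmostInvariantVector.

End NonBacktrackingEnergy.

(** * Reiter's condition, invariant means and energy decay *)

Lemma ultra_cvg_bounded (R : realType) (I : Type) (U : set_system I) (s : I -> R) (a b : R) :
  UltraFilter U -> (forall i, a <= s i <= b) -> cvg (s @ U).
Proof.
move=> UU sab.
(* The image of an ultrafilter is an ultrafilter, and this one contains the compact segment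
   [[a, b]]. *)
have FU : UltraFilter (s @ U).
  split; first exact: fmap_proper_filter.
  move=> F FF sF; apply/seteqP; split; last exact: sF.
  move=> A FA; have [//|nA] := in_ultra_setVsetC (s @^-1` A) UU.
  have FnA : F (~` A) by apply: sF.
  have F0 : F set0 by rewrite -(setICr A); exact: filterI.
  by have := @filter_not_empty _ F FF F0.
have := @segment_compact R a b; rewrite compact_ultra => /(_ _ FU).
have Fab : (s @ U) `[a, b]%classic.
  by apply: (@filterE _ U) => i; rewrite /= in_itv/= sab.
by move=> /(_ Fab)[l [_ sl]]; apply/cvg_ex; exists l.
Qed.

Section ReiterCondition.
Variables (R : realType) (G : groupType) (k : nat) (psi : letter k -> G) (H : set G).
Hypothesis psiV : forall x, psi (linv x) = (psi x)^-1%g.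
Hypothesis Hpsi : forall x h, H h -> H (psi x * h)%g.
Hypothesis Hind : forall P : G -> Prop, P 1%g ->
  (forall x h, H h -> P h -> P (psi x * h)%g) -> forall h, H h -> P h.

Let HM g h : H g -> H h -> H (g * h)%g.
Proof.
move=> Hg Hh; move: g Hg; apply: Hind => [|x g Hg IHg]; first by rewrite mul1g.
by rewrite -mulgA; exact: Hpsi.
Qed.

Definition reiter (e : R) (f : G -> R) :=
  [/\ fsupp f, forall h, 0 <= f h, forall h, f h != 0 -> H h, gsum f = 1
    & forall x, gsum (fun h => `|translate (psi x) f h - f h|) <= e].

Lemma image_mulgE (a : G) (B : set G) h :
  [set (a * g)%g | g in B] h = B (a^-1 * h)%g.
Proof.
apply/propext; split => [[g Bg <-]|Bh]; first by rewrite mulKg.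
by exists (a^-1 * h)%g; rewrite ?mulKVg.
Qed.

(** The mean of [B] is the limit of its masses under increasingly invariant [f i], along an
    ultrafilter refining [\oo]. It is invariant under letters because the defects [1 / (i + 1)] tend
    to 0, then under [H] by [Hind]. *)
Lemma reiter_amenable : (forall e : R, 0 < e -> exists f, reiter e f) -> amenable R H.
Proof.
move=> rH.
have /choice[f fP] : forall i : nat, exists f, reiter i.+1%:R^-1 f.
  by move=> i; apply: rH; rewrite invr_gt0.
have [U [UU oU]] := ultraFilterLemma (eventually_filter : ProperFilter \oo).
pose s B i := gsum (fun h => f i h * \1_B h).
have indic01 (B : set G) h : 0 <= (\1_B h : R) <= 1.
  by rewrite indicE ler0n lern1 leq_b1.
have fs i B : fsupp (fun h => f i h * \1_B h).
  by have [ff _ _ _ _] := fP i; apply: fsupp_sub ff => h ->; rewrite mul0r.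
have s0 B i : 0 <= s B i.
  apply: gsum_ge0 => h; have [_ f0 _ _ _] := fP i.
  by rewrite mulr_ge0//; case/andP: (indic01 B h).
have s1 B i : s B i <= 1.
  have [ff f0 _ <- _] := fP i; apply: ler_gsum => // h.
  by rewrite ler_piMr//; case/andP: (indic01 B h).
have cs B : cvg (s B @ U).
  by apply: (@ultra_cvg_bounded _ _ _ _ 0 1) => // i; rewrite s0 s1.
pose m B := lim (s B @ U).
have gen x B : B `<=` H -> m [set (psi x * g)%g | g in B] = m B.
  move=> BH; apply/eqP; rewrite -subr_eq0; apply/eqP.
  rewrite /m -limB//; apply: cvg_lim => //.
  suff : s [set (psi x * g)%g | g in B] i - s B i @[i --> \oo] --> (0 : R).
    by move=> s0'; apply: cvg_trans s0'; exact: (cvg_app _ oU).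
  apply/cvgr0Pnorm_le => e e0.
  have [p pe] := nat_upper_bound e^-1.
  exists p => // i /= pi.
  have [ff f0 _ _ fx] := fP i.
  have ie : i.+1%:R^-1 <= e.
    rewrite -[leRHS]invrK lef_pV2 ?posrE ?invr_gt0//.
    by rewrite (le_trans pe)// ler_nat ltnW.
  (* Moving [B] by [psi x] amounts to moving [f i] by the inverse letter. *)
  apply: le_trans ie; apply: le_trans (fx (linv x)).
  have -> : s [set (psi x * g)%g | g in B] i =
      gsum (fun h => translate (psi (linv x)) (f i) h * \1_B h).
    rewrite /s -[LHS](gsum_translate (psi (linv x))); apply: eq_gsum => h.
    rewrite /translate psiV invgK /=; congr (_ * _).
    rewrite !indicE; congr (nat_of_bool _)%:R.
    by apply/idP/idP => /set_mem Bh; apply/mem_set; move: Bh; rewrite image_mulgE mulKg.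
  have ft := fsupp_translate (psi (linv x)) ff.
  have fn : fsupp (fun h => `|translate (psi (linv x)) (f i) h - f i h|).
    exact/fsupp_norm/fsuppB.
  have ft1 : fsupp (fun h => translate (psi (linv x)) (f i) h * \1_B h).
    by apply: fsupp_sub ft => h ->; rewrite mul0r.
  rewrite -gsumB//; apply: le_trans (ler_norm_gsum _) _; first exact: fsuppB.
  apply: ler_gsum => // [|h]; first exact/fsupp_norm/fsuppB.
  by case/andP: (indic01 B h) => B0 B1; rewrite -mulrBl normrM (ger0_norm B0) ler_piMr.
have m_ind h B : H h -> B `<=` H -> m [set (h * g)%g | g in B] = m B.
  move=> Hh BH; move: h Hh; apply: Hind => [|x h Hh IHh].
    congr m; apply/seteqP; split => [_ [g Bg <-]|g Bg]; first by rewrite mul1g.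
    by exists g; rewrite ?mul1g.
  rewrite -IHh -[RHS](gen x); last by move=> _ [g Bg <-]; exact: HM (BH _ Bg).
  by rewrite image_comp; congr m; apply: eq_imagel => g _ /=; rewrite mulgA.
exists m; split.
- move=> B _; apply: limr_ge; [exact: cs|].
  by apply: filterE => i; exact: s0.
- apply: cvg_lim => //.
  have -> : s H = fun=> 1.
    apply/funext => i; have [_ _ fH <- _] := fP i; apply: eq_gsum => h.
    have [->|/fH Hh] := eqVneq (f i h) 0; first by rewrite mul0r.
    by rewrite indicE mem_set ?mulr1.
  exact: cvg_cst.
- move=> B C _ _ BC0.
  have sBC : s (B `|` C) = s B \+ s C.
    apply/funext => i; rewrite /s /= -gsumD//; apply: eq_gsum => h.
    rewrite -mulrDr !indicE in_setU; have [hB|_] := boolP (h \in B).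
      rewrite memNset ?addr0// => hC; move/set_mem : hB => hB.
      by have : (B `&` C) h by []; rewrite BC0.
    by rewrite add0r.
  by rewrite /m sBC; exact: limD.
- by move=> h B Hh BH; exact: m_ind.
Qed.

(* Cauchy-Schwarz: the squares of an almost invariant vector of [l^2] are almost
   invariant in [l^1]. *)
Lemma reiter_of_almost_inv (g : G -> R) (e : R) : 0 < e ->
  fsupp g -> (forall h, g h != 0 -> H h) -> 0 < nsq g ->
  (forall x, nsq (fun h => translate (psi x) g h - g h) <= e ^+ 2 / 4 * nsq g) ->
  reiter e (fun h => (nsq g)^-1 * g h ^+ 2).
Proof.
move=> e0 fg gH N0 almost; have fg2 := fsupp_sq fg; split.
- exact: fsuppZ.
- by move=> h; rewrite mulr_ge0 ?invr_ge0 ?sqr_ge0// ltW.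
- by move=> h; rewrite mulf_eq0 negb_or sqrf_eq0 => /andP[_ /gH].
- by rewrite gsumZ mulVf// gt_eqF.
move=> x; have ft := fsupp_translate (psi x) fg.
(* A difference of squares is a product, bounded by weighted AM-GM. As the two factors have squared
   norms at most [e^2 / 4 * nsq g] and [4 * nsq g], each term contributes [e / 2]. *)
pose b h := (nsq g)^-1 * (2^-1 * (4 / e * (translate (psi x) g h - g h) ^+ 2 +
  e / 4 * (translate (psi x) g h + g h) ^+ 2)).
have fB := fsupp_sq (fsuppB ft fg); have fD := fsupp_sq (fsuppD ft fg).
have fb : fsupp b.
  by apply/fsuppZ/fsuppZ/fsuppD; exact: fsuppZ.
apply: (@le_trans _ _ (gsum b)).
  apply: ler_gsum => [|//|h].
    apply/fsupp_norm/fsuppB; last exact: fsuppZ.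
    exact/fsupp_translate/fsuppZ.
  rewrite [translate _ (fun _ => _) _]/(_ * translate (psi x) g h ^+ 2) -mulrBr.
  rewrite normrM (@ger0_norm _ (nsq g)^-1) ?invr_ge0 ?nsq_ge0//.
  rewrite /b ler_pM2l ?invr_gt0//.
  set a := translate (psi x) g h; set c := g h.
  have [t [t0 tE]] : exists t : R, 0 < t /\ 2 / e = t.
    by exists (2 / e); rewrite divr_gt0.
  have -> : 4 / e = 2 * t by rewrite -tE; ring.
  have -> : e / 4 = 2^-1 * t^-1 by rewrite -tE; field; rewrite gt_eqF.
  rewrite ler_norml; apply/andP; split.
    rewrite -subr_ge0.
    have -> : a ^+ 2 - c ^+ 2 -
         - (2^-1 * (2 * t * (a - c) ^+ 2 + 2^-1 / t * (a + c) ^+ 2)) =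
       t^-1 * (t * (a - c) + 2^-1 * (a + c)) ^+ 2 by field; rewrite gt_eqF.
    by rewrite mulr_ge0 ?invr_ge0 ?sqr_ge0// ltW.
  rewrite -subr_ge0.
  have -> : (2^-1 * (2 * t * (a - c) ^+ 2 + 2^-1 / t * (a + c) ^+ 2)) - (a ^+ 2 - c ^+ 2) =
     t^-1 * (t * (a - c) - 2^-1 * (a + c)) ^+ 2 by field; rewrite gt_eqF.
  by rewrite mulr_ge0 ?invr_ge0 ?sqr_ge0// ltW.
rewrite !gsumZ gsumD; [|exact: fsuppZ|exact: fsuppZ].
rewrite !gsumZ -![gsum (fun _ => _ ^+ 2)]/(nsq _).
have := nsqD_le ft fg; rewrite nsq_translate => dD.
have dB := almost x.
rewrite mulrC ler_pdivrMr//.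
have e4 : 0 < e / 4 by rewrite divr_gt0.
have := ler_wpM2l (ltW e4) dD.
have e4' : 0 < 4 / e by rewrite divr_gt0.
have := ler_wpM2l (ltW e4') dB.
have -> : 4 / e * (e ^+ 2 / 4 * nsq g) = e * nsq g by field; rewrite gt_eqF.
lra.
Qed.

(** If every [theta < 1] failed, a [v] violating the bound for [theta = 1 - eta] would lose little
    energy in two steps, and its [almost_inv] would satisfy Reiter's condition. *)
Lemma energy_decay : (2 <= k)%N -> ~ amenable R H ->
  exists theta : R, [/\ 0 <= theta, theta < 1 & forall v : letter k -> G -> R,
    (forall y, fsupp (v y)) -> (forall y h, 0 <= v y h) ->
    (forall y h, v y h != 0 -> H h) ->
    energy (nb_step psi (nb_step psi v)) <= theta * energy v].
Proof.
move=> k2 nA; apply: contrapT => /forallNP nth; apply/nA/reiter_amenable => e e0.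
pose q : R := 2 * k%:R - 1; pose K := 576 * k%:R * q ^+ 2.
have kR : 2 <= k%:R :> R by rewrite ler_nat.
have q1 : 1 <= q ^+ 2 by apply: exprn_ege1; rewrite /q; lra.
have K1 : 1 < K.
  by have := ler_wpM2l (ler0n R k) q1; rewrite /K; lra.
(* The first bound matches the almost invariance required by [reiter_of_almost_inv]; the second
   gives [eta < 1] and [eta_small]. *)
pose eta := Num.min (e ^+ 2 / 4 / K) K^-1.
have K0 : 0 < K by lra.
have eta0 : 0 < eta by rewrite lt_min invr_gt0 K0 !divr_gt0// exprn_gt0.
have etaK : eta <= K^-1 by rewrite ge_min lexx orbT.
have eta1 : eta < 1 by rewrite (le_lt_trans etaK)// invf_lt1.
have Keta : K * eta <= e ^+ 2 / 4.
  by rewrite mulrC -ler_pdivlMr// ge_min lexx.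
have Keta1 : K * eta <= 1 by rewrite mulrC -ler_pdivlMr// div1r.
have /not_and3P[] := nth (1 - eta); [by rewrite subr_ge0 ltW|by rewrite ltrBlDr ltrDl|].
move=> /existsNP[v /not_implyP[fv /not_implyP[v0 /not_implyP[vH /negP]]]].
rewrite -ltNge => loss.
have f1 y : fsupp (nb_step psi v y) by exact: fsupp_nb_step.
have E0 : 0 < energy v.
  have E2 := le_trans (energy_nb_step_le psi k2 f1) (energy_nb_step_le psi k2 fv).
  have : (1 - eta) * energy v < energy v by exact: lt_le_trans loss E2.
  by rewrite mulrBl mul1r ltrBlDr ltrDl pmulr_rgt0.
have loss' : energy v - energy (nb_step psi (nb_step psi v)) <= eta * energy v.
  by move: loss; rewrite mulrBl mul1r; lra.
have small : 16 * k%:R * q ^+ 2 * eta <= 1.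
  apply: le_trans Keta1; rewrite ler_pM2r// /K ler_pM2r; last lra.
  by rewrite ler_pM2r//; lra.
pose z : letter k := (Ordinal (ltnW k2), true).
exists (fun h => (nsq (almost_inv psi v z))^-1 * almost_inv psi v z h ^+ 2).
apply: reiter_of_almost_inv => //.
- exact: fsupp_almost_inv.
- move=> h; rewrite /almost_inv /translate => gh.
  have [vz|] := eqVneq (v z h) 0; last exact: vH.
  move: gh; rewrite vz add0r => /vH/(Hpsi z); by rewrite mulKVg.
- apply: lt_le_trans (nsq_le_almost_inv psi z fv v0).
  have := energy_le_nsq k2 z fv small loss'.
  move=> /(lt_le_trans E0); rewrite pmulr_rgt0//; lra.
- move=> x; apply: le_trans (dist_almost_inv k2 psiV z fv v0 (ltW eta0) small loss' x) _.
  by rewrite ler_wpM2r ?nsq_ge0.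
Qed.

End ReiterCondition.

(** * The image of the random ray in the group *)

Section WalkInGroup.
Variables (R : realType) (k : nat) (hk : (2 <= k)%N).
Variable mu : probability (boundary hk) R.
Hypothesis hmu : is_uniform_measure mu.
Variables (G : groupType) (phi : {multiplicative free_group k -> G}).
Implicit Types (x y : letter k) (u : free_group k) (h : G) (w : boundary hk).

Local Notation Pr A := (fine (mu A)).
Local Notation first_letter := (@first_letter k hk).
Let psi x := phi (fg_letter x).

Lemma morph1 : phi 1%g = 1%g.
Proof. by apply: (mulgI (phi 1%g)); rewrite -gmulfM !mulg1. Qed.

Lemma morph_letterV x : psi (linv x) = (psi x)^-1%g.
Proof.
by apply: (mulIg (psi x)); rewrite -gmulfM fg_letterV !mulVg morph1.
Qed.

Lemma range_letterM x h : range phi h -> range phi (psi x * h)%g.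
Proof. by move=> [u _ <-]; exists (fg_letter x * u)%g => //; rewrite gmulfM. Qed.

Lemma range_ind (P : G -> Prop) : P 1%g ->
  (forall x h, range phi h -> P h -> P (psi x * h)%g) ->
  forall h, range phi h -> P h.
Proof.
move=> P1 PM _ [[s rs] _ <-]; elim: s rs => [|x s IHs] rs.
  have -> : FreeGroup rs = 1%g by exact: val_inj.
  by rewrite morph1.
have rs' : reduced s by exact: path_sorted (rs : path _ _ _).
have -> : FreeGroup rs = (fg_letter x * FreeGroup rs')%g.
  by apply: val_inj; exact: esym (@foldr_push_cat k [:: x] s rs).
by rewrite gmulfM; apply: PM => //; exists (FreeGroup rs').
Qed.

(** The law of [phi (initial w n)] split by first letter; keeping the letter is what closes the
    recursion [hitS]. *)
Definition hit n x : G -> R :=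
  fun h => Pr (first_letter x `&` [set w | phi (initial w n) = h]).

Let measurable_hit n x h :
  measurable (first_letter x `&` [set w | phi (initial w n) = h]).
Proof.
apply: measurableI; first exact: measurable_first_letter.
exact: (measurable_initial (fun u => phi u = h)).
Qed.

Lemma hit_ge0 n x h : 0 <= hit n x h.
Proof. by rewrite /hit fine_ge0. Qed.

Lemma hit_range n x h : hit n x h != 0 -> range phi h.
Proof.
move=> hit0; apply: contrapT => nh; move/eqP: hit0; apply.
rewrite /hit (_ : _ `&` _ = set0) ?measure0//.
by apply/seteqP; split => // w [_ /= wh]; apply: nh; exists (initial w n).
Qed.

Lemma fsupp_hit n x : fsupp (hit n x).
Proof.
apply: (@sub_finite_set _ _ (phi @` [set u : free_group k | size u = n])); last first.
  exact/finite_image/finite_words.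
move=> h /= hit0; apply: contrapT => nh; move/eqP: hit0; apply.
rewrite /hit (_ : _ `&` _ = set0) ?measure0//.
apply/seteqP; split => // w [_ /= wh]; apply: nh; exists (initial w n) => //.
by rewrite /= size_mkseq.
Qed.

Lemma hitS n x : hit n.+1 x = nb_step psi (hit n) x.
Proof.
apply/funext => h; rewrite /nb_step /translate /hit.
pose B := [set w : boundary hk | phi (initial w n) = ((psi x)^-1 * h)%g].
have mB : measurable B by exact: (measurable_initial (fun u => phi u = _)).
have mL := @measurable_first_letter k hk.
have -> : first_letter x `&` [set w | phi (initial w n.+1) = h] =
    first_letter x `&` (@shift k hk) @^-1` B.
  apply/seteqP; split => w [wx wh]; split => //; move: wh; rewrite /B /=;
    rewrite -[n.+1]add1n initialD initial1 gmulfM wx -/(psi x).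
    by move=> <-; rewrite mulKg.
  by move=> ->; rewrite mulKVg.
rewrite (markov hmu)//; congr (_ * _).
rewrite (Pr_first_letters mu); last exact: measurableD.
rewrite (bigD1 (linv x))//= [X in fine (mu X)](_ : _ = set0) ?measure0 ?add0r; last first.
  by apply/seteqP; split => // w [[]].
apply: eq_bigr => y yx; congr (fine (mu _)); apply/seteqP; split => w.
  by move=> [[Bw _] wy].
move=> [wy Bw]; split => //; split => // wx; move/eqP: yx; apply.
by rewrite -wy -wx.
Qed.

Lemma energy_hit_le (theta : R) : 0 <= theta ->
  (forall v : letter k -> G -> R, (forall y, fsupp (v y)) -> (forall y h, 0 <= v y h) ->
    (forall y h, v y h != 0 -> range phi h) ->
    energy (nb_step psi (nb_step psi v)) <= theta * energy v) ->
  forall n, energy (hit n.*2) <= theta ^+ n * energy (hit 0).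
Proof.
move=> theta0 decay; elim=> [|n IHn]; first by rewrite expr0 mul1r.
have -> : hit n.+1.*2 = nb_step psi (nb_step psi (hit n.*2)).
  rewrite doubleS; apply/funext => x; rewrite hitS; congr nb_step.
  by apply/funext => y; rewrite hitS.
apply: le_trans (decay _ _ _ _) _.
- by move=> y; exact: fsupp_hit.
- by move=> y h; exact: hit_ge0.
- by move=> y h; exact: hit_range.
- by rewrite exprS -mulrA ler_wpM2l.
Qed.

(** Cauchy-Schwarz: a mass of at least one half is spread over [N = 2k * |A|] pairs of a letter and
    a point of [A]. *)
Lemma energy_hit_ge n (A : set G) : finite_set A ->
  1 / 2 <= Pr [set w | A (phi (initial w n))] ->
  1 / 4 <= 2 * k%:R * (#|` fset_set A|)%:R * energy (hit n).
Proof.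
move=> fA half; set N : R := 2 * k%:R * (#|` fset_set A|)%:R.
have mA : measurable [set w : boundary hk | A (phi (initial w n))].
  exact: (measurable_initial (fun u => A (phi u))).
have PrE : Pr [set w | A (phi (initial w n))] =
    \sum_x \sum_(h <- fset_set A) hit n x h.
  rewrite (Pr_first_letters mu)//; apply: eq_bigr => x _.
  have -> : [set w | A (phi (initial w n))] `&` first_letter x =
      \bigcup_(h in A) (first_letter x `&` [set w | phi (initial w n) = h]).
    apply/seteqP; split => [w [Aw wx]|w [h Ah [wx wh]]].
      by exists (phi (initial w n)).
    by split => //=; rewrite wh.
  rewrite measure_fin_bigcup//=; last first.
    by move=> h h' _ _ [w [[_ /= <-] [_ /= <-]]].
  rewrite fsbig_finite//; under eq_bigr => h _.
    rewrite -[mu _]fineK ?fin_num_measure// -/(hit n x h); over.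
  by rewrite sumEFin.
have N0 : 0 < N.
  rewrite lt_neqAle mulr_ge0//= andbT; apply: contraTN half => /eqP N0.
  have A0 : fset_set A = fset0.
    apply/eqP; rewrite -cardfs_eq0; apply/eqP; move/esym/eqP: N0.
    rewrite !mulf_eq0 !pnatr_eq0/= => /orP[|/eqP//].
    by move=> /eqP k0; move: hk; rewrite k0.
  rewrite PrE big1 ?lt_geF// => x _.
  by rewrite A0 big_nil.
(* Summed over the [N] pairs, the constant terms give exactly 1/4, half of the available mass. *)
have amgm (a : R) : a <= (4 * N)^-1 + N * a ^+ 2.
  rewrite -subr_ge0.
  have -> : (4 * N)^-1 + N * a ^+ 2 - a = N^-1 * (N * a - 2^-1) ^+ 2.
    by field; rewrite gt_eqF.
  by rewrite mulr_ge0 ?invr_ge0 ?sqr_ge0// ltW.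
have le_E : Pr [set w | A (phi (initial w n))] <=
    \sum_x (\sum_(h <- fset_set A) (4 * N)^-1 + N * nsq (hit n x)).
  rewrite PrE; apply: ler_sum => x _.
  apply: (@le_trans _ _ (\sum_(h <- fset_set A) ((4 * N)^-1 + N * hit n x h ^+ 2))).
    by apply: ler_sum => h _; exact: amgm.
  rewrite big_split/= lerD2l -mulr_sumr ler_pM2l//.
  have fs := fsupp_sq (fsupp_hit n x).
  have f1 : fsupp (fun h => hit n x h ^+ 2 * \1_A h).
    by apply: fsupp_sub fs => h ->; rewrite mul0r.
  have -> : \sum_(h <- fset_set A) hit n x h ^+ 2 = gsum (fun h => hit n x h ^+ 2 * \1_A h).
    rewrite (gsumE fA); last first.
      move=> h /=; rewrite indicE; have [/set_mem//|_] := boolP (h \in A).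
      by rewrite mulr0 eqxx.
    rewrite big_seq [RHS]big_seq; apply: eq_bigr => h; rewrite in_fset_set// => hA.
    by rewrite indicE hA mulr1.
  apply: ler_gsum => // h; apply: ler_piMr; first exact: sqr_ge0.
  by rewrite indicE lern1 leq_b1.
have sumE : \sum_x (\sum_(h <- fset_set A) (4 * N)^-1 + N * nsq (hit n x)) =
    1 / 4 + N * energy (hit n).
  rewrite big_split/= -mulr_sumr; congr (_ + _).
  have -> : \sum_(h <- fset_set A) (4 * N)^-1 = (4 * N)^-1 * (#|` fset_set A|)%:R :> R.
    by rewrite big_const_seq count_predT iter_addr_0 -[LHS]mulr_natr.
  rewrite sum_letters_cst mulrCA -/N.
  by field; rewrite gt_eqF.
by move: le_E half; rewrite sumE; lra.
Qed.

End WalkInGroup.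

(** At time [n = 2Km], zero drift leaves half of the mass in the ball of radius [m = n / (2K)], with
    at most [C * e^(cm)] points. The energy is at most a constant times [theta^(Km)], so for large
    [m] the two contradict [energy_hit_ge]. *)
Lemma drift_neq0 (R : realType) (k : nat) (hk : (2 <= k)%N)
    (mu : probability (boundary hk) R) (hmu : is_uniform_measure mu)
    (G : groupType) (normG : G -> R) (norm0 : forall g, 0 <= normG g)
    (phi : {multiplicative free_group k -> G}) :
  ~ amenable R (range phi) ->
  grows_at_most_exponentially normG (range phi) ->
  ~ cvg_L1 mu (fun n w => normG (phi (initial w n)) / n%:R) (fun=> 0).
Proof.
move=> nA [C [c [C0 c0 growth]]] [_ _ cvg0].
have [theta [theta0 theta1 decay]] := energy_decay (@morph_letterV _ _ phi)
  (@range_letterM _ _ phi) (@range_ind _ _ phi) hk nA.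
(* [K] is so large that the decay over [2K] steps beats the growth of the ball per unit of radius by
   a factor 2. *)
have [K K0 Kc] : exists2 K : nat, (0 < K)%N & theta ^+ K * expR c <= 1 / 2.
  have ec0 : 0 < expR (- c) / 2 by rewrite divr_gt0 ?expR_gt0.
  have theta_lt1 : `|theta| < 1 by rewrite ger0_norm.
  have [K _ KP] := (cvgr0Pnorm_le _).1 (cvg_expr theta_lt1) _ ec0.
  exists K.+1 => //; have := KP K.+1 (leqnSn K); rewrite /= ger0_norm ?exprn_ge0// => thK.
  rewrite -ler_pdivlMr ?expR_gt0//; apply: le_trans thK _.
  by rewrite expRN mulrC div1r.
have KR : 0 < K%:R :> R by rewrite ltr0n.
pose a : R := (2 * K%:R)^-1.
have a0 : 0 < a by rewrite invr_gt0 mulr_gt0.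
pose Y n (w : boundary hk) := normG (phi (initial w n)) / n%:R.
have mY n : measurable_fun setT (Y n).
  exact: (measurable_fun_initial (fun u => normG (phi u) / n%:R)).
have mS n : measurable [set w | a <= Y n w].
  rewrite (_ : mkset _ = setT `&` Y n @^-1` `[a, +oo[); first exact: mY.
  by apply/seteqP; split => w /=; rewrite in_itv/= andbT; [|case].
have [N1 small] : exists N1, forall n, (N1 <= n)%N ->
    fine (mu [set w | a <= Y n w]) <= 1 / 2.
  have a2 : 0 < a / 2 by rewrite divr_gt0.
  have /fine_cvgP[finI /cvgr0Pnorm_le/(_ _ a2)lim0] := cvg0.
  have [N1 _ N1P] := filterI finI lim0.
  exists N1 => n Nn; have [fI] := N1P n Nn; rewrite /= => In.
  have mEY : measurable_fun setT (EFin \o Y n) by exact/measurable_EFinP.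
  (* Markov's inequality: the mean of [Y n] is eventually at most [a / 2]. *)
  have := le_integral_abse mu measurableT mEY a0.
  rewrite setTI (_ : [set w | _] = [set w | a <= Y n w]); last first.
    by apply/seteqP; split => w /=; rewrite lee_fin ger0_norm ?divr_ge0.
  rewrite (_ : (\int[mu]_(w in _) _)%E = (\int[mu]_w `|Y n w - 0|%:E)%E); last first.
    by apply: eq_integral => w _; rewrite subr0.
  rewrite -(fineK fI).
  rewrite [X in (_ * X)%E](_ : _ = (fine (mu [set w | a <= Y n w]))%:E); last first.
    by rewrite fineK// fin_num_measure.
  rewrite -EFinM lee_fin.
  move=> /le_trans/(_ (le_trans (ler_norm _) In)).
  by rewrite mulrC -ler_pdivlMr// mulrAC mulfV ?gt_eqF.
have [E0 E1] : 0 <= energy (hit mu phi 0) /\ 0 <= 2 * k%:R * C :> R.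
  split; first by apply: sumr_ge0 => x _; exact: nsq_ge0.
  by rewrite !mulr_ge0// ltW.
set B := 2 * k%:R * C * energy (hit mu phi 0).
have bound m : (0 < m)%N -> (N1 <= m)%N -> 1 / 4 <= B * (1 / 2) ^+ m.
  move=> m0 Nm; have [fball cball] := growth m.
  set ball := [set g | _] in fball cball.
  pose n := (K * m).*2.
  have nE : n%:R * a = m%:R :> R.
    by rewrite /n /a -muln2 !natrM; field; rewrite gt_eqF.
  have n0 : 0 < n%:R :> R by rewrite ltr0n double_gt0 muln_gt0 K0.
  have Nn : (N1 <= n)%N.
    by rewrite (leq_trans Nm)// /n -addnn (leq_trans (leq_pmull m K0))// leq_addr.
  have mball : measurable [set w : boundary hk | ball (phi (initial w n))].
    exact: (measurable_initial (fun u => ball (phi u))).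
  have half : 1 / 2 <= fine (mu [set w | ball (phi (initial w n))]).
    apply: (@le_trans _ _ (fine (mu (~` [set w | a <= Y n w])))).
      rewrite probability_setC// fineB//= ?fin_num_measure//.
      by have := small n Nn; lra.
    rewrite fine_le ?fin_num_measure//; first exact: measurableC.
    apply: le_measure; rewrite ?inE//; first exact: measurableC.
    move=> w /negP; rewrite -ltNge => Yn; split; first by exists (initial w n).
    by move: Yn; rewrite /Y ltr_pdivrMr// mulrC nE => /ltW.
  apply: le_trans (energy_hit_ge fball half) _.
  have decayn := energy_hit_le hmu theta0 decay (K * m).
  apply: le_trans (ler_wpM2l _ decayn) _; first by rewrite !mulr_ge0.
  have cm : (#|` fset_set ball|)%:R * theta ^+ (K * m) <= C * (1 / 2) ^+ m.
    apply: le_trans (ler_wpM2r _ cball) _; first by rewrite exprn_ge0.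
    rewrite expRM_natr exprM -mulrA -exprMn ler_pM2l//.
    rewrite lerXn2r ?nnegrE ?mulr_ge0 ?expR_ge0 ?exprn_ge0//.
    by rewrite mulrC.
  have := ler_wpM2l (mulr_ge0 (mulr_ge0 (ler0n R 2) (ler0n R k)) E0) cm.
  by rewrite /B; lra.
(* Once [(1 / 2)^m] is below this threshold, [B * (1 / 2)^m < 1 / 4], against [bound]. *)
have B4 : 0 < (4 * (B + 1))^-1.
  by rewrite invr_gt0 mulr_gt0// ltr_wpDl// mulr_ge0.
have half1 : `|1 / 2 : R| < 1 by rewrite ger0_norm; lra.
have [N2 _ N2P] := (cvgr0Pnorm_le _).1 (cvg_expr half1) _ B4.
have := N2P (maxn N1.+1 N2) (leq_maxr _ _).
have := bound (maxn N1.+1 N2) _ _.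
rewrite leq_max ltnS leq0n => /(_ isT); rewrite leq_max leqnSn => /(_ isT).
set r := (1 / 2) ^+ _; rewrite /= -/r => Br.
have r0 : 0 <= r by rewrite exprn_ge0.
rewrite ger0_norm// -div1r ler_pdivlMr; last by move: B4; rewrite invr_gt0.
have : 0 < r by rewrite exprn_gt0.
lra.
Qed.

Unset Implicit Arguments.

Theorem theorem1 (R : realType) (k : nat) (hk : (2 <= k)%N)
    (mu : probability (boundary hk) R) (hmu : is_uniform_measure mu)
    (G : groupType) (normG : G -> R) (hnormG : semi_norm normG)
    (phi : {multiplicative free_group k -> G}) :
  exists lambda : R,
    [/\ 0 <= lambda,
        {ae mu, forall w : boundary hk,
          normG (phi (initial w n)) / n%:R @[n --> \oo] --> lambda},
        cvg_L1 mu (fun n w => normG (phi (initial w n)) / n%:R)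
          (fun=> lambda)
      & ~ amenable R (range phi) ->
        grows_at_most_exponentially normG (range phi) ->
        0 < lambda].
Proof.
have [norm0 normM] := hnormG.
pose X n (w : boundary hk) := normG (phi (initial w n)).
pose M := \sum_(x : letter k) normG (phi (fg_letter x)).
have M0 : 0 <= M by apply: sumr_ge0 => x _; exact: norm0.
have subX n m w : X (n + m)%N w <= X n w + X m (iter n (@shift k hk) w).
  by rewrite /X initialD gmulfM.
have X1 w : X 1%N w <= M.
  rewrite /X initial1 /M (bigD1 (ray w 0%N))//= lerDl.
  by apply: sumr_ge0 => x _; exact: norm0.
have XM n w : (0 < n)%N -> X n w <= M * n%:R.
  elim: n w => // n IHn w _; have [->|n0] := posnP n; first by rewrite mulr1.
  rewrite -addn1 (le_trans (subX _ _ _))// natrD mulrDr mulr1.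
  by rewrite lerD// IHn.
have [lambda [lambda0 lambda_ae lambda_L1]] : exists lam : R,
    [/\ 0 <= lam, {ae mu, forall w, X n w / n%:R @[n --> \oo] --> lam}
      & cvg_L1 mu (fun n w => X n w / n%:R) (fun=> lam)].
  apply: (subadditive_ergodic (measurable_shift (hk := hk))
    (shift_preserving hmu) (shift_ergodic hmu) (M := M)) => //.
  - by move=> n; exact: (measurable_fun_initial (fun u => normG (phi u))).
  (* The first summand covers [n = 0], where the semi-norm of 1 may be positive. *)
  - move=> n; exists (normG (phi (fg_one k)) + M * n%:R) => w.
    rewrite ger0_norm ?norm0//; case: n => [|n].
      rewrite mulr0 addr0 /X (_ : initial w 0 = fg_one k)//; exact: val_inj.
    by rewrite (le_trans (XM _ _ _))// lerDr.
  - by move=> n w; exact: norm0.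
exists lambda; split => // nA growth; rewrite lt_neqAle lambda0 andbT.
apply/eqP => lam0; move: lambda_L1; rewrite -lam0.
exact: (drift_neq0 hmu norm0 nA growth).
Qed.
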